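(* Let $1\le q\le p<\infty$, let $\Omega\subset\mathbb{R}^d$ be compact with a probability measure $\mu$, and let $X_N\subset\mathcal{C}(\Omega)$ be an $N$-dimensional subspace satisfying $$\varepsilon_k(X_N^q,L_\infty)\le B(N/k)^{1/q},\quad 1\le k\le N,$$ where $B\ge 1$. Then for a large enough constant $C(p,q)$ (depending only on $p$ and $q$) there exist $$m\le C(p,q)B^pN^{p/q}(\log_2(2BN))^2$$ points $\xi^j\in\Omega$, $j=1,\dots,m$, such that for any $f\in X_N$ $$\frac12\|f\|_p^p\le\frac1m\sum_{j=1}^m|f(\xi^j)|^p\le\frac32\|f\|_p^p.$$
   Context: $\mathcal{C}(\Omega)$ is the space of continuous functions on $\Omega$, also denoted $L_\infty$, with norm $\|f\|_\infty:=\max_{\mathbf{x}\in\Omega}|f(\mathbf{x})|$. For $1\le p<\infty$, $\|f\|_p:=\left(\int_\Omega|f|^p\,d\mu\right)^{1/p}$. The unit $L_q$ ball of $X_N$ is $X_N^q:=\{f\in X_N:\|f\|_q\le1\}$. For a Banach space $X$ and compact $A\subset X$, the entropy numbers are, for $k=0,1,2,\dots$, $$\varepsilon_k(A,X):=\inf\Bigl\{\varepsilon>0:\ \exists\, y^1,\dots,y^{2^k}\in A,\ A\subseteq\bigcup_{j=1}^{2^k}B_X(y^j,\varepsilon)\Bigr\},$$ where $B_X(y,r)=\{x\in X:\|x-y\|\le r\}$. The points $\xi^1,\dots,\xi^m$ form a finite family; repetitions are allowed. *)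

(* Defs.v *)
From HB Require Import structures.
From mathcomp Require Import all_boot all_order all_algebra.
From mathcomp Require Import all_classical all_reals all_analysis.

Set Implicit Arguments.
Unset Strict Implicit.
Unset Printing Implicit Defensive.

Import Order.TTheory GRing.Theory Num.Theory.
Import numFieldNormedType.Exports.

Local Open Scope classical_set_scope.
Local Open Scope ring_scope.

(* R^d with its Borel sigma-algebra; it is convertible to 'rV[R]_d. *)
Definition borel_rV (R : realType) (d : nat) :=
  g_sigma_algebraType (@open 'rV[R]_d).

Definition log2 (R : realType) (x : R) : R := ln x / ln 2.

(* C(Omega): functions on the subtype Omega, which carries the topology
   induced from R^d. *)
Definition C_space (R : realType) (d : nat) (Omega : set 'rV[R]_d) :
    set (Omega -> R) :=
  [set f : Omega -> R | continuous f].
Arguments C_space {R d} Omega.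

Definition is_subspace_of_dim (R : realType) (V : lmodType R) (N : nat)
    (X : set V) : Prop :=
  exists b : 'I_N -> V,
    (forall c : 'I_N -> R,
       \sum_(i < N) c i *: b i = 0 -> forall i, c i = 0) /\
    X = [set f | exists c : 'I_N -> R, f = \sum_(i < N) c i *: b i].

Definition sup_norm (R : realType) (T : Type) (f : T -> R) : \bar R :=
  ereal_sup [set (`|f x|)%:E | x in [set: T]].

(* mu lives on R^d and is to be used with mu Omega = 1; [valL_ 0 f] is the
   extension by 0 of f to R^d, so that the integral is taken over Omega. *)
Definition Lp_norm (R : realType) (d : nat) (mu : probability (borel_rV R d) R)
    (Omega : set 'rV[R]_d) (p : R) (f : Omega -> R) : \bar R :=
  'N[mu]_(p%:E)[EFin \o (valL_ 0 f : borel_rV R d -> R)].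

Definition Lq_unit_ball (R : realType) (d : nat)
    (mu : probability (borel_rV R d) R) (Omega : set 'rV[R]_d)
    (X : set (Omega -> R)) (q : R) : set (Omega -> R) :=
  [set f | X f /\ (Lp_norm mu q f <= 1)%E].

(* The centres of the closed balls are taken in A; the value is +oo when A has
   no finite cover by balls with 2 ^ k centres. *)
Definition entropy_number (R : realType) (V : zmodType) (nrm : V -> \bar R)
    (k : nat) (A : set V) : \bar R :=
  ereal_inf [set e%:E | e in [set e : R | 0 < e /\
    exists y : 'I_(2 ^ k) -> V,
      (forall j, A (y j)) /\
      A `<=` \bigcup_j [set x | (nrm (x - y j)%R <= e%:E)%E]]].

(* Main.v *)
Require Import Defs.
From mathcomp Require Import all_boot all_order all_algebra.
From mathcomp Require Import all_classical all_reals all_analysis.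
From mathcomp Require Import measurable_realfun lra ring zify.

Set Implicit Arguments.
Unset Strict Implicit.
Unset Printing Implicit Defensive.

Import Order.TTheory GRing.Theory Num.Theory.
Import numFieldNormedType.Exports.

Local Open Scope classical_set_scope.
Local Open Scope ring_scope.

(** By homogeneity it is enough to treat [f] in [X] with [L_p] norm [1]; such
    an [f] lies in the unit [L_q] ball [A] of [X] because [q <= p].  The case
    [k = 1] of the entropy bound gives [|f| <= 4 B N^(1/q)] on [A]: two sup-norm
    balls cover [f], [0] and [- f], so two of these three functions are close
    ([symmetric_two_net_bound]).

    Fix a geometric scale of heights [t_j], with [t_j ^ p = (1/20) (21/20)^j],
    running up to this sup bound; there are [O(log (2BN))] of them.  At each
    height [A] has a finite net whose mesh is a small multiple of [t_j], and a
    net point [g] close to [f] yields a level set [E_j = {t_j <= |g|}] that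
    replaces [{t_j <= |f|}]: the layer-cake sum of
    [(t_{j+1} ^ p - t_j ^ p) 1_{E_j}] agrees with [|f| ^ p] up to factors close
    to [1] and an additive error [1/20] ([near_level], [geometric_layers_le],
    [geometric_layers_ge]).  The gain is that only finitely many sets occur, and
    that the number at height [t_j] is the size [n_j] of a net, not a product of
    sizes of nets.

    Points at which the empirical measure of all these sets is close to their
    measure come from a Chernoff bound with a union bound, made constructive: the
    points are chosen one by one so that a weighted sum of exponential moments
    never increases ([exists_sample]).  With a fixed exponent the relative error
    is a small constant, and the absolute error for a set at height [t_j] is
    [O (ln (J n_j) / m)], where [J] is the number of heights.  Hence
    [m >= C * sum_j t_j ^ p * ln (J n_j)] is enough ([discretize_of_nets]).

    It remains to bound [t_j ^ p * ln n_j] by a multiple of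
    [B^p N^(p/q) log (2BN)], for each [j] ([level_net]).  When the mesh exceeds
    [B] the entropy hypothesis gives [ln n_j = O (1 + N (B / t_j) ^ q)].  Below
    that the hypothesis says nothing, and the dimension takes over: a sup-norm
    ball of radius [M] in [X] has a net of mesh [e] of size [O (M / e) ^ N]
    ([finite_net]).  The two logarithms of the theorem are the number of heights
    and this last [ln (M / e)]. *)

(** * Nets in finite-dimensional spaces of bounded functions *)

(** The tensor-power trick: a multiplicative constant [C] is invisible to
    exponential growth, by the Bernoulli inequality. *)
Lemma leq_of_leq_exp (a b C : nat) :
  (forall l, (a ^ l <= C * b ^ l)%N) -> (a <= b)%N.
Proof.
move=> H; rewrite leqNgt; apply/negP => ltba.
(* Bernoulli inequality, multiplied by a power of [b]. *)
have bern l : (b ^ l.+1 + l.+1 * b ^ l <= b.+1 ^ l.+1)%N.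
  elim: l => [|l IHl]; first by rewrite !expn1 expn0 mul1n addn1.
  rewrite [leqRHS]expnS [X in (X + _)%N]expnS.
  have := leq_mul (leqnn b.+1) IHl; apply: leq_trans.
  rewrite mulnDr !mulSn !expnS; nia.
have b0 : (0 < b)%N.
  move: (H 1%N) ltba; case: b {bern H} => // /[!expn1] /[!muln0]; lia.
have lea : (b.+1 ^ (C * b).+1 <= a ^ (C * b).+1)%N by rewrite leq_exp2r.
have := leq_trans (leq_trans (bern _) lea) (H _).
have : (0 < b ^ (C * b))%N by rewrite expn_gt0 b0.
by rewrite [(b ^ (C * b).+1)%N]expnS; nia.
Qed.

(** A matrix of values with fewer than [N] independent rows has a nonzero
    kernel vector; the corresponding combination of the [b i] does not vanish
    identically, so one more point can be added. *)
Lemma evaluation_points (F : fieldType) (T : Type) (N : nat) (b : 'I_N -> T -> F) :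
  (forall c : 'I_N -> F, (forall x, \sum_i c i * b i x = 0) -> forall i, c i = 0) ->
  exists x : 'I_N -> T, row_free (\matrix_(j, i) b i (x j)).
Proof.
move=> indep.
suff H k : (k <= N)%N -> exists x : 'I_k -> T, row_free (\matrix_(j < k, i < N) b i (x j)).
  by have [x] := H N (leqnn N); exists x.
elim: k => [_|k IHk ltkN].
  have x : 'I_0 -> T by case.
  by exists x; apply/row_freeP; exists 0; apply/matrixP => -[].
have [x] := IHk (ltnW ltkN); set A := (X in row_free X) => freeA.
have : kermx A^T != 0.
  by rewrite kermx_eq0 /row_free mxrank_tr (eqP freeA) ltn_eqF.
case/rowV0Pn => u /sub_kermxP uA u0.
have [y uy] : exists y, \sum_i u 0 i * b i y != 0.
  apply/not_existsP => ny; case/negP: u0; apply/eqP/rowP => i.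
  rewrite (indep (u 0)) ?mxE// => y.
  by apply/eqP/negP => /negP; exact: ny.
exists (fun j : 'I_(1 + k) => match fintype.split j with inl _ => y | inr j' => x j' end).
pose v := \row_i b i y.
set A' := (X in row_free X).
have -> : A' = col_mx v A.
  by apply/matrixP => j i; rewrite !mxE; case: fintype.splitP => j' _; rewrite !mxE.
apply: inj_row_free => w wA'.
pose w0 := lsubmx (w : 'rV_(1 + k)); pose w' := rsubmx (w : 'rV_(1 + k)).
have wvA : w0 *m v + w' *m A = 0 by rewrite -mul_row_col hsubmxK.
have w00 : w0 = 0.
  have := congr1 (mulmx^~ u^T) wvA.
  have Au : A *m u^T = 0 by rewrite -[A]trmxK -trmx_mul uA trmx0.
  rewrite mul0mx mulmxDl -!mulmxA Au mulmx0 addr0 [w0]mx11_scalar mul_scalar_mx.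
  move/matrixP/(_ 0 0); rewrite !mxE => /eqP; rewrite mulf_eq0 => /orP[/eqP w00|].
    by apply/matrixP => i j; rewrite !ord1 !mxE eqxx w00.
  rewrite (_ : \sum_j _ = \sum_i u 0 i * b i y) ?(negbTE uy)//.
  by apply: eq_bigr => i _; rewrite !mxE mulrC.
have w'0 : w' = 0.
  by move: wvA; rewrite w00 mul0mx add0r => /eqP; rewrite mulmx_free_eq0// => /eqP.
by rewrite -[w](hsubmxK (w : 'rV_(1 + k))) -/w0 -/w' w00 w'0 row_mx0.
Qed.

(** Coordinates are recovered from values at [N] points by inverting a
    matrix, so they are controlled by the sup norm.  Any bound serves
    [packing_bound], where it disappears under a tensor power. *)
Lemma coordinate_bound (R : realType) (T : Type) (N : nat) (b : 'I_N -> T -> R) :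
  (forall c : 'I_N -> R, (forall x, \sum_i c i * b i x = 0) -> forall i, c i = 0) ->
  exists2 L : R, 0 < L & forall (c : 'I_N -> R) (S : R),
    (forall x, `|\sum_i c i * b i x| <= S) -> forall i, `|c i| <= L * S.
Proof.
move=> /evaluation_points[x]; set A := (X in row_free X).
rewrite row_free_unit => uA.
pose L := 1 + \sum_i \sum_j `|invmx A i j|.
have sum_ge0 (i : 'I_N) : 0 <= \sum_j `|invmx A i j| by apply: sumr_ge0.
exists L; first by apply: ltr_pwDl => //; exact: sumr_ge0.
move=> c S cS i.
pose u := \col_i c i.
have -> : c i = \sum_j invmx A i j * (\sum_i c i * b i (x j)).
  have : u = invmx A *m (A *m u) by rewrite mulKmx.
  move/matrixP/(_ i 0); rewrite !mxE => ->; apply: eq_bigr => j _.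
  by rewrite !mxE; congr (_ * _); apply: eq_bigr => k _; rewrite !mxE mulrC.
have S0 : 0 <= S := le_trans (normr_ge0 _) (cS (x i)).
apply: (le_trans (ler_norm_sum _ _ _)).
apply: (@le_trans _ _ (\sum_j `|invmx A i j| * S)).
  by apply: ler_sum => j _; rewrite normrM ler_wpM2l.
rewrite -mulr_suml ler_wpM2r//; apply: (@le_trans _ _ (L - 1)); last by rewrite gerBl.
rewrite /L addrAC subrr add0r [leRHS](bigD1 i)//= lerDl; exact: sumr_ge0.
Qed.

(** The volumetric packing bound, without volumes.  Words of length [l] over
    the [n] separated functions, read as digits in base [K], give [n ^ l]
    functions that are still [e]-separated and of size [O (K ^ l)]; the condition
    on [K] says that a difference at one digit is not cancelled by the less
    significant ones.  Rounding coordinates to a grid shows that there are at most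
    [O (K ^ l) ^ N] such functions, and [leq_of_leq_exp] removes the constant. *)
Lemma packing_bound (R : realType) (T : Type) (N n K : nat)
    (b : 'I_N -> T -> R) (S M e : R) (c : 'I_n -> 'I_N -> R) :
  (forall c : 'I_N -> R, (forall x, \sum_i c i * b i x = 0) -> forall i, c i = 0) ->
  (forall i x, `|b i x| <= S) ->
  0 < e -> (1 < K)%N -> 2 * M <= (K%:R - 1) * e ->
  (forall j x, `|\sum_i c j i * b i x| <= M) ->
  (forall j k, j != k ->
     exists x, e < `|\sum_i c j i * b i x - \sum_i c k i * b i x|) ->
  (n <= K ^ N)%N.
Proof.
move=> indep bS e0 K1 MKe cM sep.
have [L L0 coordL] := coordinate_bound indep.
pose ev (a : 'I_N -> R) x := \sum_i a i * b i x.
pose W := foldr (fun d (a : 'I_N -> R) i => c d i + K%:R * a i) (fun=> 0).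
have evW d s x : ev (W (d :: s)) x = ev (c d) x + K%:R * ev (W s) x.
  rewrite /ev mulr_sumr -big_split/=; apply: eq_bigr => i _.
  by rewrite mulrDl mulrA.
have ev0 x : ev (fun=> 0) x = 0 by rewrite /ev big1// => i _; rewrite mul0r.
have K2 : 2 <= K%:R :> R by rewrite ler_nat.
have WM s x : `|ev (W s) x| <= `|M| * (K%:R ^+ size s - 1).
  elim: s => [|d s IHs]; first by rewrite /= ev0 normr0 expr0 subrr mulr0.
  rewrite evW (le_trans (ler_normD _ _))//= normrM normr_nat.
  have cdM : `|ev (c d) x| <= `|M| := le_trans (cM d x) (ler_norm M).
  have K0 : 0 <= K%:R :> R by [].
  have M0 := normr_ge0 M.
  have := ler_wpM2l M0 K2.
  rewrite exprS; move: (ler_wpM2l K0 IHs) cdM.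
  move: (`|ev (c d) x|) (`|ev _ x|) (K%:R ^+ _) (`|M|) => X Y k A; nra.
have Wsep (s s' : seq 'I_n) : size s = size s' -> s != s' ->
    exists x, e < `|ev (W s) x - ev (W s') x|.
  elim: s s' => [|d s IHs] [|d' s']//= [ss'] nss'.
  have [ss|neqs] := eqVneq s s'.
    have ndd' : d != d' by apply: contra nss' => /eqP ->; rewrite ss.
    have [x xe] := sep _ _ ndd'; exists x.
    by rewrite -/(W (d :: s)) -/(W (d' :: s')) !evW ss opprD addrACA subrr addr0.
  have [x xe] := IHs _ ss' neqs; exists x.
  rewrite -/(W (d :: s)) -/(W (d' :: s')) !evW.
  move: (cM d x) (cM d' x) xe; rewrite -/(ev _ _) -/(ev _ _).
  set u := ev (W s) x; set v := ev (W s') x; set y := ev (c d) x; set z := ev (c d') x.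
  move=> yM zM xe.
  have -> : y + K%:R * u - (z + K%:R * v) = K%:R * (u - v) - (z - y) by ring.
  apply: lt_le_trans (lerB_dist _ _); rewrite normrM normr_nat.
  have : `|z - y| <= 2 * M.
    by rewrite (le_trans (ler_normB _ _))// [leRHS](_ : _ = M + M) ?lerD//; ring.
  by move: (`|u - v|) xe (`|z - y|) => U Ue Z; nra.
pose A : R := `|S|.
pose h : R := e / (N%:R * A + 1).
have A0 : 0 <= A by exact: normr_ge0.
have den0 : 0 < N%:R * A + 1 by rewrite ltr_wpDl// mulr_ge0// ler0n.
have h0 : 0 < h by rewrite divr_gt0.
pose D := (Num.truncn (2 * L * `|M| / h)).+1.
(* Cells of side [h] move a combination by at most [N * h * A < e]. *)
apply: (@leq_of_leq_exp _ _ (D.+1 ^ N)) => l.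
rewrite -expnM [(N * l)%N]mulnC expnM -expnMn.
pose y (s : seq 'I_n) i := (W s i + L * (`|M| * K%:R ^+ l)) / h.
pose code (s : l.-tuple 'I_n) : {ffun 'I_N -> 'I_(D * K ^ l).+1} :=
  [ffun i => inord (Num.truncn (y s i))].
have Wl (s : l.-tuple 'I_n) i : `|W s i| <= L * (`|M| * K%:R ^+ l).
  apply: coordL => x; apply: (le_trans (WM s x)); rewrite size_tuple.
  by rewrite ler_wpM2l// gerBl.
have y0 (s : l.-tuple 'I_n) i : 0 <= y s i.
  rewrite divr_ge0 ?(ltW h0)//; move: (Wl s i); rewrite ler_norml => /andP[+ _].
  by rewrite -subr_ge0 opprK.
have yD (s : l.-tuple 'I_n) i : (Num.truncn (y s i) < (D * K ^ l).+1)%N.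
  rewrite ltnS -(ler_nat R); apply: (@le_trans _ _ (y s i)); first by rewrite truncn_le.
  rewrite natrM natrX.
  apply: (@le_trans _ _ (2 * L * `|M| / h * K%:R ^+ l)).
    rewrite mulrAC ler_pM2r ?invr_gt0//.
    move: (Wl s i); rewrite ler_norml => /andP[_].
    have -> : 2 * L * `|M| * K%:R ^+ l = L * (`|M| * K%:R ^+ l) + L * (`|M| * K%:R ^+ l) by ring.
    by rewrite -(lerD2r (L * (`|M| * K%:R ^+ l))).
  by rewrite ler_wpM2r// ltW// truncnS_gt.
have code_inj : injective code.
  move=> s s' ss'; apply/val_inj/eqP/negPn/negP => nss'.
  have [|x] := Wsep s s' _ nss'; first by rewrite !size_tuple.
  apply/negP; rewrite -leNgt /ev -sumrB.
  apply: (le_trans (ler_norm_sum _ _ _)).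
  apply: (@le_trans _ _ (\sum_(i < N) h * A)).
    apply: ler_sum => i _; rewrite -mulrBl normrM ler_pM//; last exact: le_trans (bS i x) (ler_norm S).
    have tt : Num.truncn (y s i) = Num.truncn (y s' i).
      have : nat_of_ord (code s i) = nat_of_ord (code s' i) by rewrite ss'.
      by rewrite !ffunE !inordK.
    have -> : W s i - W s' i = h * (y s i - y s' i).
      by rewrite /y; field; rewrite gt_eqF.
    rewrite normrM gtr0_norm//; apply: ler_piMr; first exact: ltW.
    rewrite ler_norml; have := y0 s i; have := y0 s' i; rewrite -2!truncn_le.
    have := truncnS_gt (y s i); have := truncnS_gt (y s' i).
    rewrite tt -natr1; lra.
  rewrite sumr_const card_ord -mulr_natl /h mulrCA mulrAC ler_pdivrMr//.
  by rewrite mulrDr mulr1 lerDl ltW.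
have := leq_card _ code_inj.
rewrite card_tuple card_ord card_ffun !card_ord => /leq_trans; apply.
have : ((D * K ^ l).+1 <= D.+1 * K ^ l)%N.
  by rewrite mulSn addnC -addn1 leq_add2l expn_gt0 (ltnW K1).
by case: (N) => [|N' H]; rewrite ?expn0// leq_exp2r.
Qed.

(** A separated family of maximal cardinality is a net. *)
Lemma finite_net (R : realType) (T : Type) (N K : nat)
    (b : 'I_N -> T -> R) (S M e : R) (Y : set (T -> R)) :
  (forall c : 'I_N -> R, (forall x, \sum_i c i * b i x = 0) -> forall i, c i = 0) ->
  (forall i x, `|b i x| <= S) ->
  0 < e -> (1 < K)%N -> 2 * M <= (K%:R - 1) * e ->
  (forall f, Y f -> exists c : 'I_N -> R, forall x, f x = \sum_i c i * b i x) ->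
  (forall f, Y f -> forall x, `|f x| <= M) ->
  exists n, exists2 g : 'I_n -> T -> R, (n <= K ^ N)%N /\ (forall i, Y (g i)) &
    forall f, Y f -> exists i, forall x, `|f x - g i x| <= e.
Proof.
move=> indep bS e0 K1 MKe spanY YM.
pose separated n (g : 'I_n -> T -> R) :=
  (forall i, Y (g i)) /\
  forall j k, j != k -> exists x, e < `|g j x - g k x|.
(* [separated] families exist in bounded sizes only, so one of maximal size exists. *)
pose Q n := `[< exists g : 'I_n -> T -> R, separated n g >].
have Q0 : exists n, Q n.
  by exists 0%N; apply/asboolP; exists (fun=> fun=> 0); split=> [[]|[]].
have QK n : Q n -> (n <= K ^ N)%N.
  move=> /asboolP[g [gY gsep]].
  have [c gc] := choice (fun j => spanY _ (gY j)).
  apply: (@packing_bound _ _ N n K b S M e c) => // [j x|j k jk].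
    by rewrite -gc; exact: YM.
  by have [x xe] := gsep _ _ jk; exists x; rewrite -!gc.
case: (ex_maxnP Q0 QK) => n Qn nmax.
have /asboolP[g [gY gsep]] := Qn.
exists n, g; first by split=> //; exact: QK.
move=> f Yf; apply/not_existsP => far.
suff /nmax : Q n.+1 by rewrite ltnn.
have farf i : exists x, e < `|f x - g i x|.
  by have /existsNP[x /negP] := far i; rewrite -ltNge => ?; exists x.
apply/asboolP; exists (fun j => oapp g f (unlift ord0 j)); split=> [j|j k].
  by case: unliftP => [j' _|_] /=; [exact: gY|].
case: unliftP => [j'|] ->; case: unliftP => [k'|] -> //=.
- by rewrite (inj_eq lift_inj); exact: gsep.
- by move=> _; have [x xe] := farf j'; exists x; rewrite distrC.
Qed.

(** * Sampling finitely many sets by exponential moments *)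

Lemma integrable_affine_indic d (T : measurableType d) (R : realType)
    (P : probability T R) (I : finType) (E : I -> set T) (a : R) (b : I -> R) :
  (forall i, measurable (E i)) ->
  P.-integrable setT (fun x => (a + \sum_i b i * \1_(E i) x)%:E).
Proof.
move=> mE.
have bE i : P.-integrable setT (fun x => (b i * \1_(E i) x)%:E).
  apply: (@integrableZl _ _ _ P setT measurableT (b i) (EFin \o \1_(E i))).
  exact: integrable_indic.
under [X in _.-integrable _ X]funext => x do rewrite EFinD -sumEFin.
apply: integrableD => //; first exact: finite_measure_integrable_cst.
by apply: integrable_sum.
Qed.

Lemma integral_affine_indic d (T : measurableType d) (R : realType)
    (P : probability T R) (I : finType) (E : I -> set T) (a : R) (b : I -> R) :
  (forall i, measurable (E i)) ->
  (\int[P]_x (a + \sum_i b i * \1_(E i) x)%:E =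
   (a + \sum_i b i * fine (P (E i)))%:E)%E.
Proof.
move=> mE.
have bE i : P.-integrable setT (fun x => (b i * \1_(E i) x)%:E).
  apply: (@integrableZl _ _ _ P setT measurableT (b i) (EFin \o \1_(E i))).
  exact: integrable_indic.
under eq_integral => x _ do rewrite EFinD -sumEFin.
rewrite integralD//; [|exact: finite_measure_integrable_cst|exact: integrable_sum].
have PT : (P [set: T] = 1)%E := probability_setT P.
rewrite integral_cst// -[X in (_ * X)%E]/(P [set: T]) PT mule1 EFinD -sumEFin; congr (_ + _)%E.
rewrite integral_sum//; apply: eq_bigr => i _.
under eq_integral => x _ do rewrite EFinM.
rewrite integralZl//; last exact: integrable_indic.
by rewrite integral_indic// setIT EFinM fineK// fin_num_measure.
Qed.

(** A function that is positive on a set of full measure has a positive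
    integral. *)
Lemma exists_le0_of_integral_le0 d (T : measurableType d) (R : realType)
    (P : probability T R) (D : set T) (h : T -> R) :
  measurable D -> P D = 1%E ->
  P.-integrable setT (EFin \o h) -> (\int[P]_x (h x)%:E <= 0)%E ->
  exists2 x, D x & h x <= 0.
Proof.
move=> mD PD1 ih h0; apply: contrapT => nex.
have hpos x : D x -> 0 < h x.
  by move=> Dx; rewrite ltNge; apply/negP => hx; apply: nex; exists x.
have PDC : P (~` D) = 0%E by rewrite probability_setC// PD1 subee.
have ihD : P.-integrable D (EFin \o h) by apply: integrableS ih.
move: h0; rewrite (negligible_integral (measurableC mD))// setTD setCK.
rewrite (_ : integral _ _ _ = \int[P]_(x in D) `|(h x)%:E|)%E; last first.
  by apply: eq_integral => x /set_mem/hpos hx; rewrite gee0_abs// lee_fin ltW.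
move=> h0; have {}h0 : (\int[P]_(x in D) `|(h x)%:E| = 0)%E.
  by apply/eqP; rewrite eq_le h0 integral_ge0.
have [A [mA PA0 DA]] := (ae_eq_integral_abs P mD (measurable_int P ihD)).1 h0.
have : (P D <= P A)%E.
  apply: le_measure; rewrite ?inE// => x Dx; apply: DA => /= /(_ Dx)[] hx.
  by move: (hpos _ Dx); rewrite hx ltxx.
by rewrite PD1 PA0 lee_fin ler10.
Qed.

(** One step of the selection: the exponent is normalised so that the
    expectation of each factor is at most [1], by
    [1 + (e ^ l - 1) P E <= e ^ ((e ^ l - 1) P E)]. *)
Lemma exists_exponential_factor_le d (T : measurableType d) (R : realType)
    (P : probability T R) (D : set T) (I : finType) (E : I -> set T)
    (l c : I -> R) :
  measurable D -> P D = 1%E -> (forall i, measurable (E i)) ->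
  (forall i, 0 <= c i) ->
  exists2 x, D x &
    \sum_i c i * expR (l i * \1_(E i) x - (expR (l i) - 1) * fine (P (E i)))
      <= \sum_i c i.
Proof.
move=> mD PD1 mE c0.
pose k i := expR (- ((expR (l i) - 1) * fine (P (E i)))).
pose a := \sum_i (c i * k i - c i).
pose b i := c i * k i * (expR (l i) - 1).
have [||x Dx hx] := @exists_le0_of_integral_le0 _ _ _ P D
    (fun x => a + \sum_i b i * \1_(E i) x) mD PD1.
- exact: integrable_affine_indic.
- rewrite integral_affine_indic// lee_fin /a -big_split/= sumr_le0// => i _.
  rewrite /b; set m := fine _.
  have := expR_ge1Dx ((expR (l i) - 1) * m) ; rewrite -/m => em.
  have -> : c i * k i - c i + c i * k i * (expR (l i) - 1) * m =
            c i * (k i * (1 + (expR (l i) - 1) * m) - 1) by ring.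
  rewrite mulr_ge0_le0// subr_le0 /k -/m expRN mulrC ler_pdivrMr ?expR_gt0//.
  by rewrite mul1r.
exists x => //; rewrite -subr_le0 -sumrB; move: hx; rewrite /a -big_split/=.
congr (_ <= 0); apply: eq_bigr => i _.
rewrite /b /k expRD; have [xE|xE] := boolP (x \in E i).
  by rewrite indicE xE !mulr1; ring.
by rewrite indicE (negbTE xE) !mulr0 expR0; ring.
Qed.

(** The Chernoff bound by the method of conditional expectations: after each
    choice the accumulated factors become the new weights [c], so that no product
    measure is needed. *)
Lemma exists_sample d (T : measurableType d) (R : realType)
    (P : probability T R) (D : set T) (I : finType) (E : I -> set T)
    (l c : I -> R) (m : nat) :
  measurable D -> P D = 1%E -> (forall i, measurable (E i)) ->
  (forall i, 0 <= c i) ->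
  exists2 x : 'I_m -> T, (forall j, D (x j)) &
    \sum_i c i * expR (l i * \sum_j \1_(E i) (x j)
                       - m%:R * (expR (l i) - 1) * fine (P (E i)))
      <= \sum_i c i.
Proof.
move=> mD PD1 mE; elim: m c => [|m IHm] c c0.
  have [y _ _] := exists_exponential_factor_le l mD PD1 mE c0.
  exists (fun=> y) => [[]//|]; apply: ler_sum => i _.
  by rewrite big_ord0 mulr0 !mul0r subr0 expR0 mulr1.
have [y Dy yc] := exists_exponential_factor_le l mD PD1 mE c0.
pose c' i := c i * expR (l i * \1_(E i) y - (expR (l i) - 1) * fine (P (E i))).
have c'0 i : 0 <= c' i by rewrite mulr_ge0// expR_ge0.
have [x Dx xc] := IHm c' c'0.
exists (fun j => oapp x y (unlift ord0 j)) => [j|].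
  by case: unliftP => [j' _|_] /=.
apply: le_trans yc; apply: le_trans xc; apply: ler_sum => i _.
rewrite big_ord_recl unlift_none/=.
under eq_bigr do rewrite liftK/=.
rewrite /c' -[leRHS]mulrA -expRD -natr1.
by rewrite le_eqVlt; apply/orP; left; apply/eqP; congr (_ * expR _); ring.
Qed.

(** * Layer-cake sums over a geometric scale *)

(** The sum telescopes: it stops at the first level above [s], which is at
    most [r * s]. *)
Lemma geometric_layers_le (R : realFieldType) (r v0 s : R) (J : nat) :
  1 < r -> 0 < v0 -> 0 <= s ->
  \sum_(j < J) v0 * r ^+ j * (r - 1) * (v0 * r ^+ j <= s)%R%:R <= r * s.
Proof.
move=> r1 v00 s0.
pose v j := v0 * r ^+ j.
have v_gt0 j : 0 < v j by rewrite mulr_gt0// exprn_gt0// (lt_trans _ r1).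
suff [] : \sum_(j < J) v j * (r - 1) * (v j <= s)%R%:R <= r * s /\
          \sum_(j < J) v j * (r - 1) * (v j <= s)%R%:R <= v J by [].
elim: J => [|J [IHs IHv]].
  by rewrite big_ord0; split; [rewrite mulr_ge0// ltW// (lt_trans _ r1)|exact: ltW].
have vS : v J.+1 = r * v J by rewrite /v exprS mulrCA.
rewrite big_ord_recr/= -/(v J) vS; have vJ := v_gt0 J.
have r0 : 0 < r by apply: lt_trans r1.
case: (leP (v J) s) => vs; rewrite ?mulr1 ?mulr0 ?addr0; split=> //.
- by have := ler_wpM2l (ltW r0) vs; lra.
- by lra.
- by apply: (le_trans IHv); rewrite ler_peMl// ltW.
Qed.

(** Dually, the levels counted reach up to [u / r]; the layer below [v0] is
    lost, which is the additive error. *)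
Lemma geometric_layers_ge (R : realFieldType) (r v0 u : R) (J : nat) :
  1 < r -> 0 < v0 -> 0 <= u -> u <= v0 * r ^+ J ->
  u <= r * (v0 + \sum_(j < J) v0 * r ^+ j * (r - 1) * (v0 * r ^+ j.+1 <= u)%R%:R).
Proof.
move=> r1 v00 u0.
pose v j := v0 * r ^+ j.
have v_gt0 j : 0 < v j by rewrite mulr_gt0// exprn_gt0// (lt_trans _ r1).
pose S J := \sum_(j < J) v j * (r - 1) * (v j.+1 <= u)%R%:R.
suff [+ _] : (u <= v J -> u <= r * (v0 + S J)) /\ (v J <= u -> v0 + S J = v J) by apply.
elim: J => [|J [IHu IHv]].
  rewrite /S big_ord0 addr0 /v expr0 mulr1; split=> // uv; nra.
have vS : v J.+1 = r * v J by rewrite /v exprS mulrCA.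
have SS : S J.+1 = S J + v J * (r - 1) * (v J.+1 <= u)%R%:R by rewrite /S big_ord_recr.
have vJ := v_gt0 J.
have vlt : v J < v J.+1 by rewrite vS; nra.
split=> [uv|vu].
  rewrite SS; case: (leP (v J.+1) u) => [vu|_]; rewrite ?mulr1 ?mulr0 ?addr0.
    have := IHv (ltW (lt_le_trans vlt vu)); rewrite vS in uv; nra.
  by have [/IHu//|/ltW/IHv ->] := leP u (v J); rewrite -vS.
rewrite SS vu mulr1; have := IHv (ltW (lt_le_trans vlt vu)); rewrite vS; lra.
Qed.

(** Each set at height [j] has weight [1 / n j], so that all sets at one
    height share a total weight independent of the size of the net; the factor [2]
    inside the logarithm counts the two signs of the exponent. *)
Lemma exists_sample_levels d (T : measurableType d) (R : realType)
    (P : probability T R) (D : set T) (J : nat) (n : 'I_J -> nat)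
    (E : forall j, 'I_(n j) -> set T) (l : R) (m : nat) :
  measurable D -> P D = 1%E -> (forall j i, measurable (E j i)) ->
  exists2 x : 'I_m -> T, (forall k, D (x k)) &
    forall j i, let s := \sum_k \1_(E j i) (x k) in
      let mu := fine (P (E j i)) in
      l * s <= (expR l - 1) * (m%:R * mu) + ln (2 * J%:R * (n j)%:R) /\
      (1 - expR (- l)) * (m%:R * mu) <= l * s + ln (2 * J%:R * (n j)%:R).
Proof.
move=> mD PD1 mE.
pose I : finType := ({j : 'I_J & 'I_(n j)} * bool)%type.
pose E' (u : I) := E (tag u.1) (tagged u.1).
pose sgl (u : I) := if u.2 then l else - l.
pose c (u : I) : R := (n (tag u.1))%:R^-1.
have c0 u : 0 <= c u by rewrite invr_ge0.
have [x Dx xc] := exists_sample sgl m mD PD1 (fun u : I => mE (tag u.1) (tagged u.1)) c0.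
have sumc : \sum_u c u <= 2 * J%:R.
  rewrite -(pair_bigA _ (fun v (b : bool) => c (v, b)))/=.
  under eq_bigr => v _ do rewrite big_bool/= /c/=.
  rewrite (_ : \sum_i _ =
      \sum_(j < J) \sum_(i < n j) ((n j)%:R^-1 + (n j)%:R^-1)); last first.
    by rewrite sig_big_dep.
  apply: (@le_trans _ _ (\sum_(j < J) (2 : R))); last first.
    by rewrite sumr_const card_ord mulr_natr.
  apply: ler_sum => j _; rewrite sumr_const card_ord.
  have [->|nj] := eqVneq (n j) 0%N; first by rewrite mulr0n.
  by rewrite mulrnDl -(mulr_natr (n j)%:R^-1) mulVf ?pnatr_eq0.
exists x => // j i s mu.
have main b : let u : I := (Tagged (fun j => 'I_(n j)) i, b) in
    sgl u * s - m%:R * (expR (sgl u) - 1) * mu <= ln (2 * J%:R * (n j)%:R).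
  move=> u.
  have nj : 0 < (n j)%:R :> R by rewrite ltr0n (leq_ltn_trans _ (ltn_ord i)).
  have J0 : 0 < J%:R :> R by rewrite ltr0n (leq_ltn_trans _ (ltn_ord j)).
  rewrite -ler_expR lnK ?posrE ?mulr_gt0//.
  have := le_trans xc sumc; rewrite (bigD1 u)//= => H.
  have {H} : c u * expR (sgl u * s - m%:R * (expR (sgl u) - 1) * mu) <= 2 * J%:R.
    apply: le_trans H; rewrite lerDl; apply: sumr_ge0 => v _.
    by rewrite mulr_ge0// expR_ge0.
  by rewrite {1}/c/= mulrC ler_pdivrMr.
have := main true; have := main false; rewrite /sgl/=.
set L := ln _; set eN := expR (- l); set e := expR l; lra.
Qed.

(** * From nets at every height to discretization *)

(** The [p]-th power of the [j]-th height. *)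
Definition level (R : realType) (j : nat) : R := 20^-1 * (21 / 20) ^+ j.
(** [1 + mesh p] is the ratio of consecutive heights, so that a change by
    [mesh p] times a height is one step of the scale. *)
Definition mesh (R : realType) (p : R) : R := (21 / 20) `^ p^-1 - 1.

Lemma level_gt0 (R : realType) j : 0 < level R j.
Proof. by rewrite /level; apply: mulr_gt0; [|apply: exprn_gt0]; lra. Qed.

Lemma level_ge (R : realType) j : 20^-1 <= level R j.
Proof. by rewrite /level ler_peMr ?invr_ge0// exprn_ege1//; lra. Qed.

Lemma powRVK (R : realType) (p x : R) : 0 < p -> 0 <= x -> (x `^ p^-1) `^ p = x.
Proof. by move=> p0 x0; rewrite -powRrM mulVf ?gt_eqF// powRr1. Qed.

Lemma powRK (R : realType) (p x : R) : 0 < p -> 0 <= x -> (x `^ p) `^ p^-1 = x.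
Proof. by move=> p0 x0; rewrite -powRrM mulfV ?gt_eqF// powRr1. Qed.

Lemma powR_le_iff (R : realType) (p x y : R) : 0 < p -> 0 <= x -> 0 <= y ->
  (x `^ p <= y `^ p) = (x <= y).
Proof.
move=> p0 x0 y0; apply/idP/idP => xy.
  rewrite leNgt; apply/negP => yx.
  by move: xy; rewrite leNgt gt0_ltr_powR// nnegrE.
by rewrite ge0_ler_powR// ?nnegrE// ltW.
Qed.

Lemma mesh_gt0 (R : realType) (p : R) : 1 <= p -> 0 < mesh p.
Proof.
move=> p1; have p0 : 0 < p by apply: lt_le_trans p1.
have h : 0 <= 21 / 20 :> R by lra.
rewrite subr_gt0 ltNge -(powR_le_iff p0) ?powR_ge0// powRVK//.
by rewrite powR1 -ltNge /=; lra.
Qed.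

Lemma mesh_le (R : realType) (p : R) : 1 <= p -> mesh p <= 20^-1.
Proof.
move=> p1; rewrite lerBlDl (le_trans (ler1_powR _ _))//; try lra.
by rewrite invf_le1// (lt_le_trans _ p1).
Qed.

(** A level set of an approximation [z] lies between two level sets of [y] a
    bounded number of steps apart; the upper inclusion costs two steps because
    [(1 + a) ^ 2 * (1 - a) >= 1] for small [a]. *)
Lemma near_level (R : realType) (p v y z : R) : 1 <= p -> 0 < v ->
  `|y - z| <= mesh p * v `^ p^-1 ->
  (v `^ p^-1 <= `|z| -> v <= (21 / 20) ^+ 2 * `|y| `^ p) /\
  (v * (21 / 20) <= `|y| `^ p -> v `^ p^-1 <= `|z|).
Proof.
move=> p1 v0 yz; have p0 : 0 < p by apply: lt_le_trans p1.
set t := v `^ p^-1; have t0 : 0 < t by rewrite powR_gt0.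
have vE : v = t `^ p by rewrite powRVK// ltW.
pose r : R := (21 / 20) `^ p^-1.
have h : 0 <= 21 / 20 :> R by lra.
have rE : 21 / 20 = r `^ p by rewrite powRVK.
have a0 := mesh_gt0 p1; have a1 := mesh_le p1.
have rM : r = 1 + mesh p by rewrite /mesh -/r; ring.
have r0 : 0 < r by lra.
have zy : `|z| <= `|y| + mesh p * t.
  by rewrite -(subrK y z) addrC (le_trans (ler_normD _ _))// lerD2l distrC.
have yz' : `|y| <= `|z| + mesh p * t.
  by rewrite -(subrK z y) addrC (le_trans (ler_normD _ _))// lerD2l.
split=> [tz|].
  have -> : (21 / 20) ^+ 2 * `|y| `^ p = (r ^+ 2 * `|y|) `^ p.
    rewrite powRM ?exprn_ge0 ?(ltW r0)// -(powR_mulrn _ (ltW r0)) powRAC -rE.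
    by rewrite powR_mulrn.
  rewrite vE powR_le_iff ?mulr_ge0 ?exprn_ge0 ?(ltW r0) ?(ltW t0)//.
  have ty : (1 - mesh p) * t <= `|y| by lra.
  apply: (@le_trans _ _ (r ^+ 2 * ((1 - mesh p) * t))); last first.
    by rewrite ler_wpM2l// exprn_ge0// ltW.
  rewrite mulrA ler_peMl ?(ltW t0)// rM; nra.
rewrite {1}vE rE -powRM ?(ltW t0) ?(ltW r0)//.
rewrite powR_le_iff ?mulr_ge0 ?(ltW t0) ?(ltW r0)// => rt.
by move: rt; rewrite rM; lra.
Qed.

(** The constant [1 / 400] is the product of the exponent [1 / 20] of the
    Chernoff bound and the allowed absolute error [1 / 20]. *)
Lemma discretize_of_nets d (T : measurableType d) (R : realType)
    (P : probability T R) (D : set T) (p : R) (F : set (T -> R))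
    (J : nat) (n : 'I_J -> nat) (g : forall j, 'I_(n j) -> T -> R) (m : nat) :
  measurable D -> P D = 1%E -> 1 <= p -> (0 < m)%N ->
  (forall j i, measurable_fun setT (g j i)) ->
  (forall f, F f -> measurable_fun setT f) ->
  (forall f, F f -> (\int[P]_x (`|f x| `^ p)%:E = 1)%E) ->
  (forall f, F f -> forall x, `|f x| `^ p <= level R J) ->
  (forall f, F f -> forall j, exists i,
     forall x, `|f x - g j i x| <= mesh p * level R j `^ p^-1) ->
  \sum_(j < J) level R j / 20 * ln (2 * J%:R * (n j)%:R) <= m%:R / 400 ->
  exists2 x : 'I_m -> T, (forall k, D (x k)) &
    forall f, F f ->
      1 / 2 <= m%:R^-1 * \sum_k `|f (x k)| `^ p /\
      m%:R^-1 * \sum_k `|f (x k)| `^ p <= 3 / 2.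
Proof.
move=> mD PD1 p1 m0 mg mF intF FJ netF cost.
have p0 : 0 < p by apply: lt_le_trans p1.
pose E (j : 'I_J) (i : 'I_(n j)) := [set x | level R j `^ p^-1 <= `|g j i x|].
have mE j i : measurable (E j i).
  rewrite -[E j i]setTI; apply: measurable_fun_le => //.
  exact: measurableT_comp.
have [x Dx xE] := exists_sample_levels (20^-1 : R) m mD PD1 mE.
exists x => // f Ff.
pose i j := sval (cid (netF f Ff j)).
have fi j y : `|f y - g j (i j) y| <= mesh p * level R j `^ p^-1.
  exact: (svalP (cid (netF f Ff j))).
(* The increment from level [j] to level [j.+1]. *)
pose w (j : 'I_J) : R := level R j / 20.
pose H y := \sum_(j < J) w j * \1_(E j (i j)) y.
have w0 j : 0 <= w j by rewrite divr_ge0// ltW// level_gt0.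
have H0 y : 0 <= H y by apply: sumr_ge0 => j _; rewrite mulr_ge0.
have wE j : w j = 20^-1 * (21 / 20) ^+ j * (21 / 20 - 1).
  by rewrite /w /level; field.
have upH y : H y <= (21 / 20) ^+ 3 * `|f y| `^ p.
  have := @geometric_layers_le R (21 / 20) 20^-1 ((21 / 20) ^+ 2 * `|f y| `^ p) J.
  have -> : 21 / 20 * ((21 / 20) ^+ 2 * `|f y| `^ p) = (21 / 20) ^+ 3 * `|f y| `^ p by ring.
  have h1 : (1 : R) < 21 / 20 by lra.
  have h2 : (0 : R) < 20^-1 by lra.
  have h3 : 0 <= (21 / 20) ^+ 2 * `|f y| `^ p by rewrite mulr_ge0 ?powR_ge0// exprn_ge0; lra.
  move=> /(_ h1 h2 h3); apply: le_trans; apply: ler_sum => j _.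
  rewrite -wE ler_wpM2l// indicE ler_nat.
  have [yE|//] := boolP (y \in E j (i j)).
  have [/(_ (set_mem yE)) + _] := near_level p1 (level_gt0 R j) (fi j y).
  by rewrite /level => ->.
have lowH y : `|f y| `^ p <= (21 / 20) * (20^-1 + H y).
  have h1 : (1 : R) < 21 / 20 by lra.
  have h2 : (0 : R) < 20^-1 by lra.
  have := geometric_layers_ge h1 h2 (powR_ge0 `|f y| p) (FJ f Ff y).
  move=> /le_trans; apply; rewrite ler_pM2l; last by lra.
  rewrite lerD2l; apply: ler_sum => j _; rewrite -wE ler_wpM2l// indicE ler_nat.
  case: leP => //= yE.
  have [_ ] := near_level p1 (level_gt0 R j) (fi j y).
  rewrite {1}/level -mulrA -exprSr => /(_ yE) yE'.
  by rewrite mem_set.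
pose h := \sum_(j < J) w j * fine (P (E j (i j))).
have intH : (\int[P]_y (H y)%:E = h%:E)%E.
  have := @integral_affine_indic _ _ _ P _ (fun j => E j (i j)) 0 w (fun j => mE j (i j)).
  by under eq_integral do rewrite add0r; rewrite add0r.
have mfp : measurable_fun setT (EFin \o (fun y => `|f y| `^ p)).
  apply/measurable_EFinP.
  exact: (measurableT_comp (measurable_powR p)
    (measurableT_comp (@normr_measurable R setT) (mF f Ff))).
have mH : measurable_fun setT (EFin \o H).
  have := @integrable_affine_indic _ _ _ P _ (fun j => E j (i j)) 0 w (fun j => mE j (i j)).
  move=> /measurable_int; congr measurable_fun.
  by apply/funext => y; rewrite add0r.
have hup : h <= (21 / 20) ^+ 3.
  rewrite -lee_fin -intH.
  apply: (@le_trans _ _ (\int[P]_y (((21 / 20) ^+ 3)%:E * (`|f y| `^ p)%:E))%E).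
    apply: ge0_le_integral => //=.
    - by move=> y _; rewrite lee_fin.
    - by apply: measurable_funeM.
    - by move=> y _; rewrite -EFinM lee_fin.
  have r3 : 0 <= (21 / 20) ^+ 3 :> R by apply: exprn_ge0; lra.
  have u0 y : [set: T] y -> (0 <= (`|f y| `^ p)%:E)%E by rewrite lee_fin powR_ge0.
  by rewrite (ge0_integralZl_EFin P measurableT u0 mfp r3) intF// mule1.
have hlow : 1 <= 21 / 20 * (20^-1 + h).
  rewrite -lee_fin -(intF f Ff).
  have -> : ((21 / 20 * (20^-1 + h))%:E =
     \int[P]_y (21 / 20 * 20^-1 + \sum_(j < J) 21 / 20 * w j * \1_(E j (i j)) y)%:E)%E.
    rewrite integral_affine_indic//; congr EFin; rewrite mulrDr; congr (_ + _).
    by rewrite /h mulr_sumr; apply: eq_bigr => j _; rewrite mulrA.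
  apply: ge0_le_integral => //=.
  - by apply: measurable_int; exact: integrable_affine_indic.
  - move=> y _; rewrite lee_fin (le_trans (lowH y))// mulrDr lerD2l /H mulr_sumr.
    by apply: ler_sum => j _; rewrite mulrA.
have mR : 0 < m%:R :> R by rewrite ltr0n.
pose s (j : 'I_J) : R := \sum_k \1_(E j (i j)) (x k).
pose L := \sum_(j < J) w j * ln (2 * J%:R * (n j)%:R).
have L_le : 20 * L <= m%:R / 20 by move: cost; rewrite -/L; lra.
have HE : \sum_k H (x k) = \sum_(j < J) w j * s j.
  by rewrite /H exchange_big; apply: eq_bigr => j _; rewrite mulr_sumr.
(* From [1 + l <= e ^ l] at [l = - 1/20]. *)
have e_up : expR 20^-1 - 1 <= 19^-1 :> R.
  have := expR_ge1Dx (- 20^-1 : R); have := expR_gt0 (20^-1 : R).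
  have := expRxMexpNx_1 (20^-1 : R).
  by move: (expR _) (expR _) => a b; nra.
have e_low : 21^-1 <= 1 - expR (- 20^-1) :> R.
  have := expR_ge1Dx (20^-1 : R); have := expR_gt0 (- 20^-1 : R).
  have := expRxMexpNx_1 (20^-1 : R).
  by move: (expR _) (expR _) => a b; nra.
have mu0 j : 0 <= m%:R * fine (P (E j (i j))) by rewrite mulr_ge0// fine_ge0.
have emp_up : \sum_k H (x k) <= m%:R * (20 / 19 * h + 20^-1).
  apply: (@le_trans _ _ (20 / 19 * (m%:R * h) + 20 * L)); last by lra.
  rewrite HE /h /L !mulr_sumr -big_split/=; apply: ler_sum => j _.
  have [up _] := xE j (i j); have := mu0 j; have := w0 j; move: up.
  rewrite /= -/(s j); move: (fine _) (ln _) (s j) (w j) => mu l sj wj up wj0 muj0.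
  have : sj <= 20 / 19 * (m%:R * mu) + 20 * l by nra.
  by move=> /(ler_wpM2l wj0); lra.
have emp_low : m%:R * (20 / 21 * h - 20^-1) <= \sum_k H (x k).
  apply: (@le_trans _ _ (20 / 21 * (m%:R * h) - 20 * L)); first by lra.
  rewrite HE /h /L !mulr_sumr -sumrB; apply: ler_sum => j _.
  have [_ low] := xE j (i j); have := mu0 j; have := w0 j; move: low.
  rewrite /= -/(s j); move: (fine _) (ln _) (s j) (w j) => mu l sj wj low wj0 muj0.
  have : 20 / 21 * (m%:R * mu) - 20 * l <= sj by nra.
  by move=> /(ler_wpM2l wj0); lra.
have sum_up : \sum_k `|f (x k)| `^ p <= m%:R * (21 / 20 * 20^-1) + 21 / 20 * \sum_k H (x k).
  rewrite mulr_sumr -[m in m%:R]card_ord mulr_natl -sumr_const -big_split/=.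
  by apply: ler_sum => k _; rewrite -mulrDr.
have sum_low : \sum_k H (x k) <= (21 / 20) ^+ 3 * \sum_k `|f (x k)| `^ p.
  by rewrite mulr_sumr; apply: ler_sum => k _; exact: upH.
rewrite ![m%:R^-1 * _]mulrC ler_pdivlMr// ler_pdivrMr//.
have := ler_wpM2l (ltW mR) hup; have := ler_wpM2l (ltW mR) hlow.
move: emp_up emp_low sum_up sum_low.
by move: (\sum_k H (x k)) (\sum_k `|f (x k)| `^ p) => a b; split; lra.
Qed.

(** * Extension by zero of functions on a compact set *)

Lemma valL_val (R : realType) (V : Type) (A : set V) (f : A -> R) (x : A) :
  valL_ 0 f (set_val x) = f x.
Proof. by have := valLK 0 f => /(congr1 (@^~ x)). Qed.

Lemma valL_out (R : realType) (V : Type) (A : set V) (f : A -> R) (y : V) :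
  ~ A y -> valL_ 0 f y = 0.
Proof.
move=> Ay; rewrite /valL_/= oinv_set_val insubN//.
by apply/negP => /set_mem.
Qed.

(** Points outside [A] carry only zeros, so every pointwise inequality on the
    whole space reduces to one on [A]. *)
Lemma valL_case (R : realType) (V : Type) (A : set V) (y : V) :
  (exists x : A, forall f : A -> R, valL_ 0 f y = f x) \/
  (forall f : A -> R, valL_ 0 f y = 0).
Proof.
have [Ay|Ay] := pselect (A y); last by right=> f; exact: valL_out.
by left; exists (SigSub (mem_set Ay)) => f; rewrite -valL_val.
Qed.

Lemma compact_measurable_rV (R : realType) (d : nat) (Omega : set 'rV[R]_d) :
  compact Omega -> measurable (Omega : set (borel_rV R d)).
Proof.
move=> cO; rewrite -(setCK Omega); apply: measurableC.
apply: sub_sigma_algebra; apply: closed_openC.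
by apply: compact_closed => //; exact: norm_hausdorff.
Qed.

Lemma measurable_valL (R : realType) (d : nat) (Omega : set 'rV[R]_d)
    (f : Omega -> R) :
  compact Omega -> continuous f ->
  measurable_fun setT (valL_ 0 f : borel_rV R d -> R).
Proof.
move=> cO /(@subspace_valL_continuousP' _ Omega _ 0 f).2 cf.
have mO := compact_measurable_rV cO.
rewrite -[setT](setUv (Omega : set (borel_rV R d))).
apply/measurable_funU => //; first exact: measurableC.
split.
  apply: (measurability _ (RGenOpens.measurableE R)).
  move=> _ [_ [a [b ->] <-]].
  have : open (valL_ 0 f @^-1` `]a, b[ : set (subspace Omega)).
    by move/continuousP : cf; apply; exact: interval_open.
  case/open_subspaceP => V oV VE; rewrite setIC -VE.
  by apply: measurableI => //; exact: sub_sigma_algebra.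
apply: (eq_measurable_fun (cst 0 : borel_rV R d -> R)); last exact: measurable_cst.
by move=> y yO; rewrite valL_out//; exact: set_mem yO.
Qed.

Lemma bounded_of_continuous (R : realType) (d : nat) (Omega : set 'rV[R]_d)
    (f : Omega -> R) :
  compact Omega -> continuous f -> exists S, forall x, `|f x| <= S.
Proof.
move=> cO /(@subspace_valL_continuousP' _ Omega _ 0 f).2 cf.
have /compact_bounded[S [_ HS]] := continuous_compact cf cO.
exists (`|S| + 1) => x; apply: HS; first by rewrite ltr_pwDr// ler_norm.
by exists (set_val x); [exact: set_valP|rewrite valL_val].
Qed.

(** * Sizes of the nets and number of heights *)

Lemma lnX_le (R : realType) (n K N : nat) :
  (0 < n)%N -> (n <= K ^ N)%N -> ln (n%:R : R) <= N%:R * ln K%:R.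
Proof.
move=> n0 nK; have [K0|K0] := posnP K.
  move: nK; rewrite K0; case: N => [|N]; last by rewrite exp0n//; case: n n0.
  by rewrite expn0 => nK; rewrite mul0r ln_le0// lern1.
rewrite mulr_natl -lnXn ?ltr0n// -natrX ler_ln ?posrE ?ltr0n ?expn_gt0 ?K0//.
by rewrite ler_nat.
Qed.

Definition count_constant (R : realType) (p : R) : R :=
  (ln (20 * 4 `^ p) + p) / ln (21 / 20) + 1.

Section parameters.
Context (R : realType) (p q B : R) (N : nat).
Hypotheses (q1 : 1 <= q) (qp : q <= p) (B1 : 1 <= B) (N0 : (0 < N)%N).

(* [G] is the sup bound of the unit ball up to a factor [4], and [V = G ^ p]. *)
Let G := B * N%:R `^ q^-1.
Let V := B `^ p * N%:R `^ (p / q).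
Let Lam := log2 (2 * B * N%:R).
Let a := mesh p.

Let N1 : 1 <= N%:R :> R. Proof. by rewrite ler1n. Qed.
Let q0 : 0 < q. Proof. exact: lt_le_trans q1. Qed.
Let p1 : 1 <= p. Proof. exact: le_trans qp. Qed.
Let p0 : 0 < p. Proof. exact: lt_le_trans p1. Qed.
Let B0 : 0 < B. Proof. exact: lt_le_trans B1. Qed.
Let a0 : 0 < a. Proof. exact: mesh_gt0. Qed.

Lemma sup_scale_ge : B <= G.
Proof.
rewrite ler_peMr ?(ltW B0)//; apply: (@le_trans _ _ (N%:R `^ 0)); first by rewrite powRr0.
by rewrite ler_powR// invr_ge0 ltW.
Qed.

Lemma sup_scale_le : G <= B * N%:R.
Proof. by rewrite ler_wpM2l ?(ltW B0)// ler1_powR// invf_le1. Qed.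

Lemma sup_scale_powR : G `^ p = V.
Proof. by rewrite powRM ?powR_ge0 ?(ltW B0)// -powRrM (mulrC _ p). Qed.

Lemma sup_scale_powRq : G `^ q = B `^ q * N%:R.
Proof. by rewrite powRM ?powR_ge0 ?(ltW B0)// powRVK. Qed.

Lemma sample_scale_ge1 : 1 <= V.
Proof.
rewrite -sup_scale_powR; apply: (@le_trans _ _ (1 `^ p)); first by rewrite powR1.
apply: ge0_ler_powR; rewrite ?nnegrE ?(ltW p0)//.
  by rewrite (le_trans (ltW B0)) ?sup_scale_ge.
exact: le_trans B1 sup_scale_ge.
Qed.

Lemma sample_scale_ge : B `^ p * N%:R <= V.
Proof.
rewrite ler_wpM2l ?powR_ge0//.
by apply: le1r_powR => //; rewrite ler_pdivlMr// mul1r.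
Qed.

Lemma ln2_bounds : 0 < ln (2 : R) <= 1.
Proof.
apply/andP; split; first by rewrite ln_gt0// ltr1n.
by have := @le_ln1Dx R 1; rewrite (_ : 1 + 1 = 2)//; apply; lra.
Qed.

Lemma ln_le_log2 : ln (2 * B * N%:R) <= Lam.
Proof.
have /andP[l0 l1] := ln2_bounds.
rewrite ler_pdivlMr// ler_piMr// ln_ge0//.
by have := ler_pM ler01 ler01 B1 N1; lra.
Qed.

Lemma log2_ge1 : 1 <= Lam.
Proof.
have /andP[l0 l1] := ln2_bounds.
rewrite ler_pdivlMr// mul1r ler_ln ?posrE// ?mulr_gt0 ?ltr0n//.
by have := ler_pM ler01 ler01 B1 N1; lra.
Qed.

Lemma ln_sup_scale_bounds : 0 <= ln G <= Lam.
Proof.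
have G1 := le_trans B1 sup_scale_ge; have G0 : 0 < G := lt_le_trans B0 sup_scale_ge.
rewrite ln_ge0//=; apply: le_trans ln_le_log2.
have D0 : 0 < 2 * B * N%:R by rewrite !mulr_gt0 ?ltr0n.
rewrite ler_ln ?posrE//.
apply: (le_trans sup_scale_le); have : 0 <= B * N%:R by rewrite mulr_ge0// ltW.
lra.
Qed.

(** Heights with mesh above [B]: [k] is the first index with
    [B (N / k) ^ (1/q)] below the mesh, and it does not exceed [N] exactly because
    the mesh is larger than [B].  The cost [v * k] is largest at the top height,
    as [q <= p]. *)
Lemma entropy_net_cost (v : R) : 0 < v -> v <= (4 * G) `^ p -> B < a * v `^ p^-1 ->
  exists k : nat, [/\ (1 <= k <= N)%N, B * (N%:R / k%:R) `^ q^-1 < a * v `^ p^-1 &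
    v * k%:R <= 4 `^ p * (1 + a `^ (- q)) * V].
Proof.
move=> v0 vG; set t := v `^ p^-1 => Bat.
have t0 : 0 < t by rewrite powR_gt0.
have at0 : 0 < a * t by rewrite mulr_gt0.
pose z := N%:R * (B / (a * t)) `^ q.
have z0 : 0 <= z by rewrite mulr_ge0 ?powR_ge0.
exists (Num.truncn z).+1.
set k := (Num.truncn z).+1.
have k0 : 0 < k%:R :> R by rewrite ltr0n.
have zk : z < k%:R by exact: truncnS_gt.
have Bat0 : 0 < B / (a * t) by rewrite divr_gt0.
split.
- rewrite ltn0Sn/= ltnNge -(ler_nat R) -ltNge /k.
  apply: (@le_lt_trans _ _ z); first by rewrite truncn_le.
  rewrite /z gtr_pMr ?ltr0n//; apply: (@lt_le_trans _ _ (1 `^ q)); last by rewrite powR1.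
  by rewrite gt0_ltr_powR ?nnegrE ?(ltW Bat0)// ltr_pdivrMr// mul1r.
- rewrite mulrC -ltr_pdivlMr//.
  have -> : a * t / B = ((a * t / B) `^ q) `^ q^-1.
    by rewrite powRK// divr_ge0 ?(ltW at0) ?(ltW B0).
  rewrite gt0_ltr_powR ?invr_gt0 ?nnegrE ?powR_ge0 ?divr_ge0//.
  have -> : (a * t / B) `^ q = ((B / (a * t)) `^ q)^-1.
    rewrite -[in LHS]invf_div -(powR_inv1 (ltW Bat0)) -powRrM mulN1r.
    by rewrite powRN.
  rewrite ltr_pdivrMr// mulrC ltr_pdivlMr ?powR_gt0//.
- have kz : k%:R <= 1 + z by rewrite -natr1 addrC lerD2l truncn_le.
  have tv : v = t `^ p by rewrite powRVK// ltW.
  have G0 : 0 < G := lt_le_trans B0 sup_scale_ge.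
  have G40 : 0 < 4 * G by rewrite mulr_gt0.
  have t4 : t <= 4 * G by rewrite -(powR_le_iff p0 (ltW t0) (ltW G40)) -tv.
  have E : v * z = G `^ q * a `^ (- q) * t `^ (p - q).
    rewrite tv powRB; last by rewrite (gt_eqF t0) implybT.
    rewrite /z powRM ?(ltW B0) ?invr_ge0 ?(ltW at0)// sup_scale_powRq.
    rewrite -powR_inv1 ?(ltW at0)// -powRrM mulN1r powRM ?(ltW a0) ?(ltW t0)//.
    by rewrite (powRN t); ring.
  have vz : v * z <= a `^ (- q) * (4 `^ p * V).
    rewrite E (mulrC (_ `^ q)) -mulrA ler_wpM2l ?powR_ge0//.
    apply: (@le_trans _ _ ((4 * G) `^ q * (4 * G) `^ (p - q))).
      apply: ler_pM; rewrite ?powR_ge0//.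
        have G4 : G <= 4 * G by move: G0; move: G => g g0; lra.
        by apply: ge0_ler_powR; rewrite ?nnegrE ?(ltW q0) ?(ltW G0) ?(ltW G40).
      by apply: ge0_ler_powR; rewrite ?nnegrE ?subr_ge0 ?(ltW t0) ?(ltW G40).
    rewrite -powRD; last by rewrite (gt_eqF G40) implybT.
    by rewrite addrC subrK powRM ?(ltW G0)// sup_scale_powR.
  move: vG; rewrite powRM ?(ltW G0)// sup_scale_powR => vG.
  by have := ler_wpM2l (ltW v0) kz; lra.
Qed.

(** Heights with mesh at most [B]: there [v <= (B / a) ^ p], and the power
    [N ^ (p/q)] absorbs the dimension [N] in the exponent of the size of the net. *)
Lemma volumetric_net_cost (v : R) : 20^-1 <= v -> a * v `^ p^-1 <= B ->
  exists K : nat, [/\ (1 < K)%N, 2 * (4 * G) <= (K%:R - 1) * (a * v `^ p^-1) &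
    v * (N%:R * ln K%:R) <= a `^ (- p) * (ln (160 / a + 2) + 1) * (V * Lam)].
Proof.
move=> v20; set t := v `^ p^-1 => aB.
have v0 : 0 < v by apply: lt_le_trans v20; lra.
have t0 : 0 < t by rewrite powR_gt0.
have at0 : 0 < a * t by rewrite mulr_gt0.
have G1 := le_trans B1 sup_scale_ge.
have G0 : 0 < G := lt_le_trans B0 sup_scale_ge.
have t20 : 20^-1 <= t.
  apply: (@le_trans _ _ (20^-1 `^ p^-1)).
    by apply: ger1_powR; rewrite ?invf_le1//; lra.
  by apply: ge0_ler_powR; rewrite ?nnegrE ?invr_ge0 ?(ltW p0) ?(ltW v0)//; lra.
pose z := 2 * (4 * G) / (a * t).
have z0 : 0 <= z by rewrite divr_ge0 ?(ltW at0)// !mulr_ge0// ltW.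
exists (Num.truncn z).+2; split => //.
  rewrite -ler_pdivrMr// -/z -[_.+2%:R]natr1 addrK ltW//; exact: truncnS_gt.
set K := _.+2.
have K0 : 0 < K%:R :> R by rewrite ltr0n.
have Kz : K%:R <= (160 / a + 2) * G.
  have zG : z <= 160 / a * G.
    rewrite /z ler_pdivrMr// mulrA.
    rewrite (_ : 160 / a * G * (a * t) = 160 * G * t); last by field; rewrite gt_eqF.
    by nra.
  have : K%:R <= z + 2.
    by rewrite -[K%:R]natr1 -natr1 -addrA -[1 + 1]/(2 : R) lerD2r truncn_le.
  by rewrite mulrDl; nra.
have c0 : 1 < 160 / a + 2.
  have : 0 < 160 / a by rewrite divr_gt0.
  lra.
have lnK : ln K%:R <= (ln (160 / a + 2) + 1) * Lam.
  apply: (@le_trans _ _ (ln (160 / a + 2) + ln G)).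
    have c00 : 0 < 160 / a + 2 by apply: lt_trans c0.
    have cG : 0 < (160 / a + 2) * G by rewrite mulr_gt0.
    by rewrite -lnM ?posrE// ler_ln ?posrE.
  have /andP[lG0 lGL] := ln_sup_scale_bounds; have L1 := log2_ge1.
  have l0 : 0 <= ln (160 / a + 2) by rewrite ln_ge0// ltW.
  by rewrite [leRHS]mulrDl mul1r; apply: lerD => //; rewrite ler_peMr.
have lK0 : 0 <= ln (K%:R : R) by rewrite ln_ge0// ler1n.
have vN : v * N%:R <= a `^ (- p) * V.
  apply: (@le_trans _ _ (a `^ (- p) * (B `^ p * N%:R))); last first.
    by rewrite ler_wpM2l ?powR_ge0// sample_scale_ge.
  rewrite mulrA ler_wpM2r// mulrC powRN ler_pdivlMr ?powR_gt0// mulrC.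
  have -> : v = t `^ p by rewrite powRVK// ltW.
  rewrite -powRM ?(ltW a0) ?(ltW t0)//.
  by apply: ge0_ler_powR; rewrite ?nnegrE ?(ltW p0) ?(ltW at0) ?(ltW B0).
rewrite mulrA; apply: (le_trans (ler_pM _ lK0 vN lnK)).
  by rewrite mulr_ge0// ltW.
by rewrite le_eqVlt; apply/orP; left; apply/eqP; ring.
Qed.

(** The first height above the sup bound of the unit ball. *)
Lemma level_count : exists J : nat,
  [/\ (4 * G) `^ p <= level R J,
      forall j, (j < J)%N -> level R j <= (4 * G) `^ p &
      J%:R <= count_constant p * Lam].
Proof.
have G0 : 0 < G := lt_le_trans B0 sup_scale_ge.
set W := (4 * G) `^ p.
have W0 : 0 < W by rewrite powR_gt0// mulr_gt0.
have rho0 : 0 < 21 / 20 :> R by lra.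
have lrho : 0 < ln (21 / 20 : R) by rewrite ln_gt0//; lra.
have W20 : 0 < 20 * W by rewrite mulr_gt0.
have lW : ln (20 * W) <= (ln (20 * 4 `^ p) + p) * Lam.
  have c0 : 0 < 20 * 4 `^ p :> R by rewrite mulr_gt0// powR_gt0.
  have -> : 20 * W = 20 * 4 `^ p * G `^ p by rewrite /W powRM ?(ltW G0)// mulrA.
  rewrite lnM ?posrE ?powR_gt0// ln_powR [leRHS]mulrDl; apply: lerD.
    rewrite ler_peMr ?log2_ge1// ln_ge0//.
    have := powR_ge0 (4 : R) p; have : 1 <= 4 `^ p :> R.
      apply: (@le_trans _ _ 4); first by lra.
      by apply: le1r_powR => //; lra.
    lra.
  by rewrite ler_wpM2l ?(ltW p0)//; case/andP: ln_sup_scale_bounds.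
have lvl j : (level R j <= W) = (j%:R * ln (21 / 20 : R) <= ln (20 * W)).
  rewrite /level (mulr_natl _ j) -lnXn// ler_ln ?posrE ?exprn_gt0//.
  by rewrite [20^-1 * _]mulrC ler_pdivrMr// [W * _]mulrC.
have lvl' j : (W <= level R j) = (ln (20 * W) <= j%:R * ln (21 / 20 : R)).
  rewrite /level (mulr_natl _ j) -lnXn// ler_ln ?posrE ?exprn_gt0//.
  by rewrite [20^-1 * _]mulrC ler_pdivlMr// [W * _]mulrC.
have lW0 : 0 <= ln (20 * W).
  rewrite ln_ge0//; have : 1 <= W.
    apply: (@le_trans _ _ (1 `^ p)); first by rewrite powR1.
    have G4 : 1 <= 4 * G by have := le_trans B1 sup_scale_ge; move: (G) => g; lra.
    by apply: ge0_ler_powR; rewrite ?nnegrE ?(ltW p0) ?(le_trans ler01 G4).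
  by lra.
set z := ln (20 * W) / ln (21 / 20).
have z0 : 0 <= z by rewrite divr_ge0// ltW.
exists (Num.truncn z).+1; split.
- by rewrite lvl' -ler_pdivrMr// ltW// truncnS_gt.
- move=> j; rewrite ltnS => jz; rewrite lvl -ler_pdivlMr//.
  by apply: le_trans (_ : (Num.truncn z)%:R <= _); rewrite ?ler_nat// truncn_le.
rewrite -natr1 /count_constant mulrDl mul1r; apply: lerD; last exact: log2_ge1.
apply: (@le_trans _ _ z); first by rewrite truncn_le.
by rewrite /z mulrAC ler_pM2r// invr_gt0.
Qed.

End parameters.

(** * Entropy numbers, unit balls and norms *)

Lemma sup_norm_le (R : realType) (T : Type) (f : T -> R) (e : R) :
  (sup_norm f <= e%:E)%E -> forall x, `|f x| <= e.
Proof.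
move=> fe x; rewrite -lee_fin; apply: le_trans fe.
by apply: ereal_sup_ubound; exists x.
Qed.

Lemma entropy_number_net (R : realType) (T : Type) (A : set (T -> R))
    (k : nat) (v e : R) :
  (entropy_number (@sup_norm R T) k A <= v%:E)%E -> v < e ->
  exists2 y : 'I_(2 ^ k) -> T -> R, (forall j, A (y j)) &
    forall f, A f -> exists j, forall x, `|f x - y j x| <= e.
Proof.
move=> Av ve; have : (entropy_number (@sup_norm R T) k A < e%:E)%E.
  by apply: le_lt_trans Av _; rewrite lte_fin.
move=> /ereal_inf_lt[_ [e' [_ [y [Ay cov]]] <-]]; rewrite lte_fin => e'e.
exists y => // f /cov[j _ /= /sup_norm_le fj]; exists j => x.
exact: le_trans (fj x) (ltW e'e).
Qed.

(** Of [f], [0] and [- f] two share a ball of radius [e], hence are within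
    [2 * e] of each other. *)
Lemma symmetric_two_net_bound (R : realType) (T : Type) (A : set (T -> R))
    (y : 'I_(2 ^ 1) -> T -> R) (e : R) :
  A 0 -> (forall f, A f -> A (- f)) ->
  (forall f, A f -> exists j, forall x, `|f x - y j x| <= e) ->
  forall f, A f -> forall x, `|f x| <= 2 * e.
Proof.
move=> A0 AN net f Af x.
have [i fi] := net f Af; have [j fj] := net _ (AN f Af); have [k fk] := net 0 A0.
have ijk : [\/ i = j, i = k | j = k].
  case: i j k {fi fj fk} => [[|[|//]] ?] [[|[|//]] ?] [[|[|//]] ?];
  by [constructor 1; apply: val_inj|constructor 2; apply: val_inj|constructor 3; apply: val_inj].
have := fi x; have := fj x; have := fk x.
rewrite /= !ler_norml => /andP[+ +] /andP[+ +] /andP[+ +].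
have -> : (0 : T -> R) x = 0 by [].
have -> : (- f) x = - f x by [].
by case: ijk => -> *; apply/andP; split; lra.
Qed.

Lemma poweR_Lp_norm (R : realType) (d : nat) (mu : probability (borel_rV R d) R)
    (Omega : set 'rV[R]_d) (p : R) (f : Omega -> R) : 0 < p ->
  (Lp_norm mu p f `^ p =
   \int[mu]_x (`|(valL_ 0 f : borel_rV R d -> R) x| `^ p)%:E)%E.
Proof. by move=> p0; rewrite /Lp_norm poweR_Lnorm ?gt_eqF. Qed.

Lemma Lp_norm_le1 (R : realType) (d : nat) (mu : probability (borel_rV R d) R)
    (Omega : set 'rV[R]_d) (p : R) (f : Omega -> R) : 0 < p ->
  (\int[mu]_x (`|(valL_ 0 f : borel_rV R d -> R) x| `^ p)%:E <= 1)%E ->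
  (Lp_norm mu p f <= 1)%E.
Proof.
move=> p0; rewrite -poweR_Lp_norm//.
have L0 : (0 <= Lp_norm mu p f)%E by exact: Lnorm_ge0.
case: (Lp_norm mu p f) L0 => [r| |//]; last by rewrite poweRyr ?gt_eqF.
rewrite poweR_EFin !lee_fin => r0 rp1.
by rewrite -(powR_le_iff p0 r0 ler01) powR1.
Qed.

(** Weighted arithmetic-geometric inequality for [u ^ p] and [1]; integrated,
    it shows that the unit [L_p] ball lies in the unit [L_q] ball. *)
Lemma powR_le_convex (R : realType) (p q u : R) : 0 < q -> q <= p -> 0 <= u ->
  u `^ q <= q / p * u `^ p + (1 - q / p).
Proof.
move=> q0 qp u0; have p0 : 0 < p by apply: lt_le_trans qp.
(* Young inequality needs [1 < p / q]. *)
have [->|neq] := eqVneq q p; first by rewrite divff ?gt_eqF// mul1r subrr addr0.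
have qltp : q < p by rewrite lt_neqAle neq.
have s0 : 0 < p / q by rewrite divr_gt0.
have r0 : 0 < p / (p - q) by rewrite divr_gt0 ?subr_gt0.
have := @conjugate_powR R (u `^ q) 1 (p / q) (p / (p - q)) (powR_ge0 _ _) ler01 s0 r0.
rewrite mulr1 powR1 -powRrM mulrCA divff ?gt_eqF// mulr1 !invf_div.
have -> : q / p + (p - q) / p = 1 by field; rewrite gt_eqF.
move=> /(_ erefl); rewrite mul1r.
have -> : (p - q) / p = 1 - q / p by field; rewrite gt_eqF.
by rewrite mulrC.
Qed.

(** * Discretization of the subspace *)

Lemma lincomb_fctE (R : realType) (T : Type) (N : nat) (b : 'I_N -> T -> R)
    (c : 'I_N -> R) (x : T) :
  (\sum_i c i *: b i) x = \sum_i c i * b i x.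
Proof. by rewrite fct_sumE. Qed.

(** The sum of the constants of the two kinds of nets. *)
Definition net_constant (R : realType) (p q : R) : R :=
  4 `^ p * (1 + mesh p `^ (- q)) + mesh p `^ (- p) * (ln (160 / mesh p + 2) + 1).

(** The factor [400] matches the budget in [discretize_of_nets]; the last [+ 1]
    pays for rounding the number of points up to an integer. *)
Definition sample_constant (R : realType) (p q : R) : R :=
  400 * (count_constant p * (2 * 4 `^ p * count_constant p + net_constant p q)) + 1.

Lemma net_constant_ge0 (R : realType) (p q : R) : 1 <= p -> 0 <= net_constant p q.
Proof.
move=> p1; have a0 : 0 < mesh p := mesh_gt0 p1.
have c1 : 0 < 160 / mesh p by rewrite divr_gt0.
rewrite addr_ge0// mulr_ge0 ?powR_ge0// addr_ge0 ?powR_ge0// ln_ge0//.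
lra.
Qed.

Lemma count_constant_ge0 (R : realType) (p : R) : 0 <= p -> 0 <= count_constant p.
Proof.
move=> p0; rewrite addr_ge0// divr_ge0 ?ln_ge0//; last by lra.
rewrite addr_ge0// ln_ge0//; have : 1 <= 4 `^ p :> R.
  by rewrite -[leLHS](powRr0 (4 : R)) ler_powR//; lra.
lra.
Qed.

Lemma sample_constant_gt0 (R : realType) (p q : R) :
  1 <= p -> 0 < sample_constant p q.
Proof.
move=> p1; have c0 := count_constant_ge0 (le_trans ler01 p1).
by rewrite ltr_wpDl// !mulr_ge0// addr_ge0 ?net_constant_ge0// !mulr_ge0// powR_ge0.
Qed.

Section subspace.
Context (R : realType) (d : nat) (Omega : set 'rV[R]_d).
Context (mu : probability (borel_rV R d) R).
Context (p q B : R) (N : nat) (X : set (Omega -> R)).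
Hypotheses (q1 : 1 <= q) (qp : q <= p) (B1 : 1 <= B) (N0 : (0 < N)%N).
Hypotheses (cO : compact Omega) (XC : X `<=` C_space Omega).
Hypothesis dimX : is_subspace_of_dim N X.
Hypothesis entropyX : forall k : nat, (1 <= k <= N)%N ->
  (entropy_number (@sup_norm R Omega) k (Lq_unit_ball mu X q)
     <= (B * (N%:R / k%:R) `^ q^-1)%:E)%E.

Let p1 : 1 <= p. Proof. exact: le_trans qp. Qed.
Let q0 : 0 < q. Proof. exact: lt_le_trans q1. Qed.
Let p0 : 0 < p. Proof. exact: lt_le_trans p1. Qed.
Let A := Lq_unit_ball mu X q.
Let G := B * N%:R `^ q^-1.
Let V := B `^ p * N%:R `^ (p / q).
Let Lam := log2 (2 * B * N%:R).
Let ext (f : Omega -> R) : borel_rV R d -> R := valL_ 0 f.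
Let Int (r : R) (f : Omega -> R) := (\int[mu]_x (`|ext f x| `^ r)%:E)%E.

Lemma subspace_scale (c : R) f : X f -> X (c *: f).
Proof.
have [b [_ ->]] := dimX => -[e ->]; exists (fun i => c * e i).
by rewrite scaler_sumr; apply: eq_bigr => i _; rewrite scalerA.
Qed.

Lemma subspace0 : X 0.
Proof.
have [b [_ ->]] := dimX; exists (fun=> 0).
by rewrite big1// => i _; rewrite scale0r.
Qed.

Lemma measurable_ext f : X f -> measurable_fun setT (ext f).
Proof. by move=> Xf; apply: measurable_valL => //; exact: XC. Qed.

Lemma ext_scale c f x : ext (c *: f) x = c * ext f x.
Proof.
by rewrite /ext; have [[y xy]|x0] := valL_case R Omega x; [rewrite !xy|rewrite !x0 mulr0].
Qed.

Lemma measurable_ext_powR r f : X f ->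
  measurable_fun setT (EFin \o (fun x => `|ext f x| `^ r)).
Proof.
move=> Xf; apply/measurable_EFinP; exact: (measurableT_comp (measurable_powR r)
  (measurableT_comp (@normr_measurable R setT) (measurable_ext Xf))).
Qed.

Lemma Int_ge0 r f : (0 <= Int r f)%E.
Proof. by apply: integral_ge0 => x _; rewrite lee_fin powR_ge0. Qed.

Lemma Int_scale r c f : X f -> Int r (c *: f) = ((`|c| `^ r)%:E * Int r f)%E.
Proof.
move=> Xf; rewrite /Int.
have u0 y : [set: borel_rV R d] y -> (0 <= (`|ext f y| `^ r)%:E)%E.
  by rewrite lee_fin powR_ge0.
have c0 := powR_ge0 `|c| r.
rewrite -(ge0_integralZl_EFin mu measurableT u0 (measurable_ext_powR r Xf) c0).
by apply: eq_integral => x _; rewrite ext_scale normrM powRM.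
Qed.

Lemma Int_lty r f : 0 < r -> X f -> (Int r f < +oo)%E.
Proof.
move=> r0 Xf; have [S fS] := bounded_of_continuous cO (XC Xf).
have PT : (mu [set: borel_rV R d] = 1)%E := probability_setT mu.
apply: (@le_lt_trans _ _ (\int[mu]_x (cst (`|S| `^ r)%:E) x)%E); last first.
  by rewrite integral_cst// -[X in (_ * X)%E]/(mu [set: borel_rV R d]) PT mule1 ltry.
apply: ge0_le_integral => //.
- exact: measurable_ext_powR.
- move=> x _; rewrite lee_fin; apply: ge0_ler_powR; rewrite ?nnegrE ?(ltW r0)//.
  rewrite /ext; have [[y xy]|x0] := valL_case R Omega x.
    by rewrite xy (le_trans (fS y))// ler_norm.
  by rewrite x0 normr0.
Qed.

Lemma unit_ball_Lp f : X f -> (Int p f <= 1)%E -> A f.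
Proof.
move=> Xf fp; split => //; apply: Lp_norm_le1 => //.
have PT : (mu [set: borel_rV R d] = 1)%E := probability_setT mu.
have qp0 : 0 <= q / p by rewrite divr_ge0// ltW.
have qp1 : 0 <= 1 - q / p by rewrite subr_ge0 ler_pdivrMr// mul1r.
have u0 y : [set: borel_rV R d] y -> (0 <= (`|ext f y| `^ p)%:E)%E.
  by rewrite lee_fin powR_ge0.
apply: (@le_trans _ _ (\int[mu]_x ((q / p)%:E * (`|ext f x| `^ p)%:E + (1 - q / p)%:E))%E).
  apply: ge0_le_integral => //.
  - exact: (measurable_ext_powR q Xf).
  - apply: emeasurable_funD => //.
    by apply: measurable_funeM; exact: (measurable_ext_powR p Xf).
  - by move=> x _; rewrite lee_fin powR_le_convex.
rewrite ge0_integralD//; first last.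
- by apply: measurable_funeM; exact: (measurable_ext_powR p Xf).
- by move=> x _; rewrite mule_ge0// lee_fin powR_ge0.
rewrite (ge0_integralZl_EFin mu measurableT u0 (measurable_ext_powR p Xf) qp0).
rewrite integral_cst// -[X in (_ + _ * X)%E]/(mu [set: borel_rV R d]) PT mule1.
rewrite -/(Int p f) (_ : 1%E = ((q / p)%:E * 1 + (1 - q / p)%:E)%E); last first.
  by rewrite mule1 -EFinD addrC subrK.
by rewrite leeD2r// lee_pmul// ?lee_fin// Int_ge0.
Qed.

Lemma unit_ball0 : A 0.
Proof.
apply: unit_ball_Lp; first exact: subspace0.
rewrite (_ : Int p 0 = 0%E)//; apply: integral0_eq => x _.
rewrite /ext (_ : valL_ 0 0 x = 0) ?normr0 ?powR0 ?gt_eqF//.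
by have [[y ->]|->] := valL_case R Omega x.
Qed.

Lemma unit_ballN f : A f -> A (- f).
Proof.
move=> [Xf f1]; split; first by rewrite -scaleN1r; exact: subspace_scale.
move: f1; rewrite /Lp_norm -oppe_Lnorm; congr (_ <= _)%E.
congr Lnorm; apply/funext => x.
rewrite -[LHS]/(- (valL_ 0 f x)%:E)%E -[RHS]/((valL_ 0 (- f) x)%:E) -EFinN; congr EFin.
by have [[y xy]|x0] := valL_case R Omega x; [rewrite !xy|rewrite !x0 oppr0].
Qed.

(** A Nikolskii inequality, from the first entropy number. *)
Lemma unit_ball_sup f : A f -> forall x, `|f x| <= 4 * G.
Proof.
have G0 : 0 < G by rewrite mulr_gt0 ?powR_gt0 ?ltr0n// (lt_le_trans _ B1).
have E1 := entropyX (k := 1) (andb_true_intro (conj (erefl _) N0)).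
have [|y Ay cov] := @entropy_number_net _ _ _ _ _ (2 * G) E1.
  by rewrite divr1 -/G; lra.
move=> Af x; rewrite (_ : 4 * G = 2 * (2 * G)); last by ring.
exact: (symmetric_two_net_bound unit_ball0 unit_ballN cov).
Qed.

(** The entropy hypothesis serves the heights whose mesh exceeds [B], and the
    dimension of [X] the others. *)
Lemma level_net (v : R) : 20^-1 <= v -> v <= (4 * G) `^ p ->
  exists u : {n : nat & 'I_n -> Omega -> R},
    [/\ (0 < projT1 u)%N, forall i, X (projT2 u i),
      forall f, A f -> exists i, forall x,
        `|f x - projT2 u i x| <= mesh p * v `^ p^-1 &
      v * ln (projT1 u)%:R <=
        net_constant p q * (V * Lam)].
Proof.
move=> v20 vG; have v0 : 0 < v by apply: lt_le_trans v20; lra.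
have V1 : 1 <= V := sample_scale_ge1 q1 qp B1 N0.
have L1 : 1 <= Lam := log2_ge1 B1 N0.
have a0 : 0 < mesh p := mesh_gt0 p1.
rewrite /net_constant; set Chi := 4 `^ p * _; set Clo := _ * (_ + 1).
have Chi0 : 0 <= Chi.
  by rewrite mulr_ge0 ?powR_ge0// addr_ge0// powR_ge0.
have Clo0 : 0 <= Clo.
  rewrite mulr_ge0 ?powR_ge0// addr_ge0// ln_ge0//.
  have : 0 < 160 / mesh p by rewrite divr_gt0.
  lra.
have VL : V <= V * Lam by rewrite ler_peMr// (le_trans _ V1).
have VL0 : 0 <= V * Lam by rewrite mulr_ge0 ?(le_trans ler01).
have [Ba|aB] := ltP B (mesh p * v `^ p^-1).
  have [k [kN Bk vk]] := entropy_net_cost q1 qp B1 N0 v0 vG Ba.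
  have [y Ay cov] := entropy_number_net (entropyX kN) Bk.
  exists (existT _ (2 ^ k)%N y); split => //=.
  - by rewrite expn_gt0.
  - by move=> i; have [] := Ay i.
  have /andP[l0 l1] := ln2_bounds R.
  apply: (@le_trans _ _ (v * k%:R)).
    by rewrite ler_wpM2l ?(ltW v0)// natrX lnXn// -[ln _ *+ _]mulr_natl ler_piMr.
  apply: (le_trans vk); rewrite mulrDl.
  apply: (@le_trans _ _ (Chi * (V * Lam))); first by rewrite ler_wpM2l.
  by rewrite lerDl mulr_ge0.
have [K [K1 MK vK]] := volumetric_net_cost q1 qp B1 N0 v20 aB.
have [b [indep XE]] := dimX.
have Xb i : X (b i).
  rewrite XE; exists (fun j => (j == i)%:R).
  rewrite (bigD1 i)//= eqxx scale1r big1 ?addr0// => j /negbTE ->.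
  by rewrite scale0r.
have [S bS] := choice (fun i => bounded_of_continuous cO (XC (Xb i))).
have indep' (c : 'I_N -> R) : (forall x, \sum_i c i * b i x = 0) -> forall i, c i = 0.
  by move=> c0; apply: indep; apply/funext => x; rewrite lincomb_fctE c0.
have bS' i x : `|b i x| <= \sum_j `|S j|.
  rewrite (le_trans (bS i x))// (le_trans (ler_norm _))//.
  by rewrite [leRHS](bigD1 i)//= lerDl sumr_ge0.
have at0 : 0 < mesh p * v `^ p^-1 by rewrite mulr_gt0// powR_gt0.
have spanA f : A f -> exists c : 'I_N -> R, forall x, f x = \sum_i c i * b i x.
  move=> [+ _]; rewrite XE => -[c ->]; exists c => x; exact: lincomb_fctE.
have [n [y [nK Ay] cov]] := finite_net indep' bS' at0 K1 MK spanA unit_ball_sup.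
have n0 : (0 < n)%N.
  by have [i _] := cov 0 unit_ball0; apply: leq_ltn_trans (ltn_ord i).
exists (existT _ n y); split => //=.
- by move=> i; have [] := Ay i.
apply: (@le_trans _ _ (v * (N%:R * ln K%:R))).
  by rewrite ler_wpM2l ?(ltW v0)// lnX_le.
by apply: (le_trans vK); rewrite [leRHS]mulrDl lerDr mulr_ge0.
Qed.

(** On [X] the [L_p] seminorm is a norm: if [f] had norm zero, all multiples of
    [f] would lie in the unit ball, which is bounded in sup norm. *)
Lemma subspace_vanishing f : X f -> Int p f = 0%E -> forall x, f x = 0.
Proof.
move=> Xf f0 x.
have cf (c : R) : `|c| * `|f x| <= 4 * G.
  rewrite -normrM; apply: (@unit_ball_sup (c *: f)).
  apply: unit_ball_Lp; first exact: subspace_scale.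
  by rewrite Int_scale// f0 mule0.
apply/eqP/negPn/negP => fx0; have fx : 0 < `|f x| by rewrite normr_gt0.
have := cf ((4 * G + 1) / `|f x|).
rewrite normrM normfV normr_id divfK ?gt_eqF//.
by have := ler_norm (4 * G + 1); lra.
Qed.

Lemma normalized_discretization : mu Omega = 1%E ->
  exists (m : nat) (xi : 'I_m -> Omega),
    [/\ (0 < m)%N, m%:R <= sample_constant p q * (V * Lam ^+ 2) &
      forall f, X f -> Int p f = 1%E ->
        1 / 2 <= m%:R^-1 * \sum_k `|f (xi k)| `^ p /\
        m%:R^-1 * \sum_k `|f (xi k)| `^ p <= 3 / 2].
Proof.
move=> muO; rewrite /sample_constant.
set C1 := net_constant p q; set C2 := count_constant p.
set C3 := C2 * (2 * 4 `^ p * C2 + C1).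
have C10 : 0 <= C1 by exact: net_constant_ge0.
have [J [J1 J2 J3]] := level_count q1 qp B1 N0.
have V1 : 1 <= V := sample_scale_ge1 q1 qp B1 N0.
have L1 : 1 <= Lam := log2_ge1 B1 N0.
have L0 : 0 <= Lam := le_trans ler01 L1.
have V0 : 0 <= V := le_trans ler01 V1.
have c4 : 0 <= 2 * 4 `^ p :> R by rewrite mulr_ge0 ?powR_ge0.
have G0 : 0 < G by rewrite mulr_gt0 ?powR_gt0 ?ltr0n// (lt_le_trans _ B1).
have GV : (4 * G) `^ p = 4 `^ p * V.
  by rewrite powRM ?(ltW G0)//; congr (_ * _); exact: sup_scale_powR.
have netJ (j : 'I_J) := level_net (level_ge R j) (J2 j (ltn_ord j)).
have [u uP] := choice netJ.
pose F := [set ext f | f in [set f | X f /\ Int p f = 1%E]].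
(* The budget of [discretize_of_nets] is [m / 400]. *)
pose m := (Num.truncn (400 * C3 * (V * Lam ^+ 2))).+1.
pose g (j : 'I_J) (i : 'I_(projT1 (u j))) := ext (projT2 (u j) i).
have J0 : 0 <= J%:R :> R by [].
have {}J3 : J%:R <= C2 * Lam by exact: J3.
have C20 : 0 <= C2.
  exact: (count_constant_ge0 (ltW p0)).
have cost : \sum_(j < J) level R j / 20 * ln (2 * J%:R * (projT1 (u j))%:R) <= C3 * (V * Lam ^+ 2).
  apply: (@le_trans _ _ (\sum_(j < J) (2 * 4 `^ p * C2 + C1) * (V * Lam))).
    apply: ler_sum => j _; have [n0 _ _ lnu] := uP j.
    have J0' : 0 < J%:R :> R by rewrite ltr0n (leq_ltn_trans _ (ltn_ord j)).
    rewrite lnM ?posrE ?ltr0n// ?mulr_gt0//.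
    have l0 := level_gt0 R j.
    have lJ : ln (2 * J%:R) <= 2 * (C2 * Lam).
      by rewrite (le_trans (ltW (ln_sublinear _)))// ?mulr_gt0// ler_wpM2l.
    have lV : level R j <= 4 `^ p * V by rewrite -GV J2.
    have lJl : level R j * ln (2 * J%:R) <= (2 * 4 `^ p * C2) * (V * Lam).
      apply: (@le_trans _ _ (level R j * (2 * (C2 * Lam)))).
        by rewrite ler_wpM2l// ltW.
      rewrite [leRHS](_ : _ = 4 `^ p * V * (2 * (C2 * Lam))); last by ring.
      by rewrite ler_wpM2r//; apply: mulr_ge0 => //; apply: mulr_ge0.
    have lnu0 : 0 <= ln (projT1 (u j))%:R :> R by rewrite ln_ge0// ler1n.
    have lnJ0 : 0 <= ln (2 * J%:R) :> R.
      rewrite ln_ge0//; have : 1 <= J%:R :> R by rewrite ler1n -(ltr_nat R).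
      by lra.
    have : level R j / 20 * (ln (2 * J%:R) + ln (projT1 (u j))%:R) <=
           level R j * (ln (2 * J%:R) + ln (projT1 (u j))%:R).
      by rewrite ler_wpM2r ?addr_ge0//; lra.
    by move: lnu; rewrite -/C1 => lnu; lra.
  rewrite sumr_const card_ord -[leLHS]mulr_natl.
  have K0 : 0 <= (2 * 4 `^ p * C2 + C1) * (V * Lam).
    by apply: mulr_ge0; [rewrite addr_ge0 ?C10// mulr_ge0|apply: mulr_ge0].
  apply: (le_trans (ler_wpM2r K0 J3)).
  by rewrite /C3 le_eqVlt; apply/orP; left; apply/eqP; ring.
have C30 : 0 <= C3.
  by apply: mulr_ge0 => //; rewrite addr_ge0 ?C10// mulr_ge0.
have VL1 : 1 <= V * Lam ^+ 2 by rewrite mulr_ege1// exprn_ege1.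
have [||||||x Dx xP] := @discretize_of_nets _ _ R mu Omega p F J _ g m
    (compact_measurable_rV cO) muO p1 (ltn0Sn _).
- by move=> j i; have [_ Xu _ _] := uP j; exact: measurable_ext.
- by move=> _ [f [Xf _] <-]; exact: measurable_ext.
- by move=> _ [f [_ f1] <-].
- move=> _ [f [Xf f1] <-] x; apply: le_trans J1.
  have Af : A f by apply: unit_ball_Lp; rewrite ?f1.
  have G40 : 0 <= 4 * G by rewrite mulr_ge0// ltW.
  apply: ge0_ler_powR; rewrite ?nnegrE ?(ltW p0)//.
  rewrite /ext; have [[y xy]|x0] := valL_case R Omega x.
    by rewrite xy; exact: unit_ball_sup.
  by rewrite x0 normr0.
- move=> _ [f [Xf f1] <-] j; have [_ _ cov _] := uP j.
  have Af : A f by apply: unit_ball_Lp; rewrite ?f1.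
  have [i fi] := cov f Af; exists i => x.
  rewrite /g /ext; have [[y xy]|x0] := valL_case R Omega x.
    by rewrite !xy.
  by rewrite !x0 subrr normr0 mulr_ge0 ?powR_ge0// ltW// mesh_gt0.
- apply: (le_trans cost).
  have : 400 * C3 * (V * Lam ^+ 2) < m%:R by exact: truncnS_gt.
  move: (Lam ^+ 2) (m%:R) => l2 M; lra.
exists m, (fun k => SigSub (mem_set (Dx k))); split => //.
- have z0 : 0 <= 400 * C3 * (V * Lam ^+ 2).
    by rewrite -mulrA mulr_ge0// mulr_ge0// (le_trans ler01).
  have : (Num.truncn (400 * C3 * (V * Lam ^+ 2)))%:R <= 400 * C3 * (V * Lam ^+ 2).
    by rewrite truncn_le.
  by rewrite /m -natr1; move: VL1; lra.
move=> f Xf f1; have := xP (ext f); rewrite (eq_bigr (fun k => `|f (SigSub (mem_set (Dx k)))| `^ p)).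
  by apply; exists f.
by move=> k _; rewrite /ext -valL_val.
Qed.

Lemma discretization : mu Omega = 1%E ->
  exists (m : nat) (xi : 'I_m -> Omega),
    [/\ (0 < m)%N, m%:R <= sample_constant p q * (V * Lam ^+ 2) &
      forall f, X f ->
        ((2^-1)%:E * Int p f <= (m%:R^-1 * \sum_k `|f (xi k)| `^ p)%:E)%E /\
        ((m%:R^-1 * \sum_k `|f (xi k)| `^ p)%:E <= (3 / 2)%:E * Int p f)%E].
Proof.
move=> muO; have [m [xi [m0 mC disc]]] := normalized_discretization muO.
exists m, xi; split => // f Xf.
have := Int_lty p0 Xf; have := Int_ge0 p f.
case E : (Int p f) => [r| |]//; rewrite lee_fin le_eqVlt => /predU1P[r0|r0] _.
  rewrite -r0 !mule0 big1 ?mulr0// => k _.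
  have -> : f (xi k) = 0 by apply: subspace_vanishing => //; rewrite E -r0.
  by rewrite normr0 powR0// gt_eqF.
pose c := r `^ (- p^-1).
have c0 : 0 <= c by exact: powR_ge0.
have cp : `|c| `^ p = r^-1.
  by rewrite ger0_norm// -powRrM mulNr mulVf ?gt_eqF// powR_inv1// ltW.
have cf1 : Int p (c *: f) = 1%E.
  by rewrite Int_scale// E cp -EFinM mulVf// gt_eqF.
have [] := disc _ (subspace_scale c Xf) cf1.
have -> : \sum_k `|(c *: f) (xi k)| `^ p = r^-1 * \sum_k `|f (xi k)| `^ p.
  rewrite mulr_sumr; apply: eq_bigr => k _.
  by rewrite -[(c *: f) _]/(c * f (xi k)) normrM powRM// cp.
rewrite mulrCA [_ * (m%:R^-1 * _)]mulrC ler_pdivlMr// ler_pdivrMr// => lo up.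
by rewrite -!EFinM !lee_fin; split=> //; rewrite mul1r in lo.
Qed.

End subspace.

Unset Implicit Arguments.

Theorem corollary2p1 (R : realType) (p q : R) (hq : 1 <= q) (hqp : q <= p) :
  exists C : R, 0 < C /\
  forall (d : nat) (Omega : set 'rV[R]_d)
    (mu : probability (borel_rV R d) R)
    (N : nat) (X : set (Omega -> R)) (B : R),
    compact Omega ->
    mu Omega = 1%E ->
    (0 < N)%N ->
    X `<=` C_space Omega ->
    is_subspace_of_dim N X ->
    1 <= B ->
    (forall k : nat, (1 <= k <= N)%N ->
      (entropy_number (@sup_norm R Omega) k (Lq_unit_ball mu X q)
        <= (B * (N%:R / k%:R) `^ q^-1)%:E)%E) ->
    exists (m : nat) (xi : 'I_m -> Omega),
      [/\ (0 < m)%N,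
          m%:R <= C * B `^ p * N%:R `^ (p / q) * log2 (2 * B * N%:R) ^+ 2 &
          forall f : Omega -> R, X f ->
            ((2^-1)%:E * Lp_norm mu p f `^ p
               <= (m%:R^-1 * \sum_(j < m) `|f (xi j)| `^ p)%:E)%E /\
            ((m%:R^-1 * \sum_(j < m) `|f (xi j)| `^ p)%:E
               <= (3 / 2)%:E * Lp_norm mu p f `^ p)%E].

Proof.
have p1 : 1 <= p := le_trans hq hqp.
have p0 : 0 < p by apply: lt_le_trans p1.
exists (sample_constant p q); split; first exact: sample_constant_gt0.
move=> d Omega mu N X B cO muO N0 XC dimX B1 ent.
have [m [xi [m0 mC disc]]] := discretization hq hqp B1 N0 cO XC dimX ent muO.
exists m, xi; split => //; first by move: mC; rewrite !mulrA.
by move=> f Xf; rewrite poweR_Lp_norm//; exact: disc.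
Qed.
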